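(* Let $\lambda$ be a partition, let $\pi=\mathrm{dom}(\lambda)$ be the corresponding dominant permutation, and let $w\in S_\infty$ satisfy $w\leq_L \pi$. Then $$\Delta\,\mathfrak S_w^\pi(x;y)=\sum_{w\lessdot_\pi t_{ab}w}\bigl(1+|A(w,t_{ab}w)|+|B(w,t_{ab}w)|\bigr)\,\mathfrak S^\pi_{t_{ab}w}(x;y),$$ where the sum is over all transpositions $t_{ab}$ ($a<b$) with $w\lessdot_\pi t_{ab}w$, and $$A(w,t_{ab}w):=\{k>b \mid w^{-1}(a)<w^{-1}(k)<w^{-1}(b)\},$$ $$B(w,t_{ab}w):=\{k>b\mid \pi w^{-1}(b)<\pi w^{-1}(k)<\pi w^{-1}(a)\}.$$
   Context: Permutations. $\mathbb N=\{1,2,\dots\}$; $S_\infty$ is the group of permutations of $\mathbb N$ with finite support, products being composition of functions. For $a<b$, $t_{ab}$ is the transposition swapping $a$ and $b$, and $s_k=t_{k\,k+1}$. $\ell(w)$ is the least number of simple transpositions $s_k$ whose product is $w$. Write $w\lessdot t_{ab}w$ if $\ell(t_{ab}w)=\ell(w)+1$. The left weak order $\leq_L$ is the reflexive transitive closure of the relations $w\lessdot s_kw$ with $\ell(s_kw)=\ell(w)+1$. Write $w\lessdot_\pi t_{ab}w$ if both $w\lessdot t_{ab}w$ and $t_{ab}w\leq_L\pi$. Dominant permutations. A partition is a weakly decreasing sequence of nonnegative integers $\lambda=(\lambda_1\ge\lambda_2\ge\cdots)$ with finite sum. For $w\in S_\infty$, $D(w)=\{(i,j)\in\mathbb N^2\mid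 i<w^{-1}(j),\ j<w(i)\}$. $\pi$ is dominant, and $\pi=\mathrm{dom}(\lambda)$, if $D(\pi)=\{(i,j)\in\mathbb N^2\mid j\le\lambda_i\}$. Polynomials. $\mathfrak S_w(x)\in\mathbb Z_{\ge0}[x_1,x_2,\dots]$ denotes the Schubert polynomial of $w$ (the generating function $\sum_P \prod_{(i,j)\in P}x_i$ over reduced pipe dreams $P$ of $w$, where $(i,j)\in P$ are the positions of the crosses; equivalently the usual Lascoux–Schützenberger Schubert polynomial). When $w\leq_L\pi=\mathrm{dom}(\lambda)$, every monomial of $\mathfrak S_w(x)$ divides $x^\lambda=\prod_i x_i^{\lambda_i}$, and the $\pi$-padded Schubert polynomial is $$\mathfrak S^\pi_w(x;y):=y^\lambda\,\mathfrak S_w\bigl(\tfrac{x_1}{y_1},\tfrac{x_2}{y_2},\dots\bigr)\in\mathbb Z[x_1,x_2,\dots;y_1,y_2,\dots],\qquad y^\lambda=\prod_i y_i^{\lambda_i}.$$ The differential operator is $\Delta:=\sum_{i=1}^\infty x_i\frac{\partial}{\partial y_i}$. *)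

(* Defs.v *)
From Stdlib Require Import Relation_Operators.
From HB Require Import structures.
From mathcomp Require Import all_boot all_order all_algebra finmap.
From mathcomp Require Import boolp classical_sets cardinality fsbigop.
From mathcomp.multinomials Require Import monalg.

Set Implicit Arguments.
Unset Strict Implicit.
Unset Printing Implicit Defensive.

Import GRing.Theory.

(* Positions are counted from 0: the positive integer i of the mathematical
   text is the natural number i - 1 here, for the points permuted by an
   element of S_oo as well as for the indices of the x_i, the y_i, the parts
   of a partition, the simple transpositions and the rows and columns of
   diagrams. *)

(* A finitely supported injection nat -> nat is a bijection. *)
Record sinf : predArgType :=
  SInf { sinf_val :> {fsfun nat -> nat}; sinf_inj : fsinjectiveb sinf_val }.
HB.instance Definition _ := [isSub for sinf_val].
HB.instance Definition _ := [Choice of sinf by <:].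

Lemma sinfP (u v : sinf) : u =1 v -> u = v.
Proof. by move=> uv; apply/val_inj/fsfunP. Qed.

Lemma sinf_injective (w : sinf) : injective w.
Proof. exact/fsinjectiveP/sinf_inj. Qed.

Section SinfGroup.

Implicit Types u v w : sinf.

Fact sinf_one_subproof : fsinjectiveb ([fsfun] : {fsfun nat -> nat}).
Proof. by apply/fsinjectiveP => i j; rewrite !fsfun0E. Qed.
Definition sinf_one : sinf := SInf sinf_one_subproof.

Fact sinf_mul_subproof u v :
  fsinjectiveb (fsfun_comp u v).
Proof. exact/fsinjectiveP/fscomp_inj/sinf_injective/sinf_injective. Qed.
Definition sinf_mul u v : sinf := SInf (sinf_mul_subproof u v).

Lemma sinf_mulE u v i : sinf_mul u v i = u (v i).
Proof. exact: fscompE. Qed.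

Definition sinf_inv_fun w : {fsfun nat -> nat} :=
  [fsfun k in finsupp w =>
     nth k (finsupp w) (index k [seq w i | i <- finsupp w])].

Fact sinf_inv_perm w : perm_eq [seq w i | i <- finsupp w] (finsupp w).
Proof.
have [wI wS] := (fsinjP 0 1).1 (sinf_injective (w := w)).
have Hu : uniq [seq w i | i <- finsupp w].
  by rewrite map_inj_uniq ?fset_uniq//; exact: sinf_injective.
apply: uniq_perm; rewrite ?fset_uniq//.
have Hs : {subset [seq w i | i <- finsupp w] <= finsupp w}.
  by move=> _ /mapP[i iw ->]; exact: (wS (FSetSub iw)).
by move: (uniq_min_size Hu Hs); rewrite size_map leqnn => /(_ isT)[].
Qed.

Fact sinf_invK w : cancel (sinf_inv_fun w) w.
Proof.
move=> k; rewrite /sinf_inv_fun fsfunE; case: ifPn => [kw|]; last first.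
  by move/fsfun_dflt.
have km : k \in [seq w i | i <- finsupp w] by rewrite (perm_mem (sinf_inv_perm w)).
rewrite -[RHS](nth_index (w k) km) (nth_map k) //.
by rewrite -(size_map w) index_mem.
Qed.

Fact sinf_inv_subproof w : fsinjectiveb (sinf_inv_fun w).
Proof. exact/fsinjectiveP/(can_inj (sinf_invK w)). Qed.
Definition sinf_inv w : sinf := SInf (sinf_inv_subproof w).

Fact sinf_mulA : associative sinf_mul.
Proof. by move=> u v w; apply: sinfP => i; rewrite !sinf_mulE. Qed.
Fact sinf_mul1 : left_id sinf_one sinf_mul.
Proof. by move=> w; apply: sinfP => i; rewrite sinf_mulE fsfun0E. Qed.
Fact sinf_mulr1 : right_id sinf_one sinf_mul.
Proof. by move=> w; apply: sinfP => i; rewrite sinf_mulE fsfun0E. Qed.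
Fact sinf_mulV : right_inverse sinf_one sinf_inv sinf_mul.
Proof.
by move=> w; apply: sinfP => i; rewrite sinf_mulE fsfun0E; exact: sinf_invK.
Qed.
Fact sinf_mulVl : left_inverse sinf_one sinf_inv sinf_mul.
Proof.
move=> w; apply: sinfP => i; apply: (@sinf_injective w).
by rewrite -sinf_mulE sinf_mulA sinf_mulV sinf_mul1 fsfun0E.
Qed.

HB.instance Definition _ := isGroup.Build sinf
  sinf_mulA sinf_mul1 sinf_mulr1 sinf_mulVl sinf_mulV.

End SinfGroup.

Local Open Scope group_scope.

Lemma mulsE (u v : sinf) i : (u * v) i = u (v i).
Proof. exact: sinf_mulE. Qed.

Definition transp_fun (a b : nat) : {fsfun nat -> nat} :=
  [fsfun k in [fset a; b]%fset => if k == a then b else a].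

Lemma transp_funE a b k :
  transp_fun a b k = if k == a then b else if k == b then a else k.
Proof. by rewrite /transp_fun fsfunE !inE; case: eqP; case: eqP. Qed.

Lemma transp_funK a b : involutive (transp_fun a b).
Proof.
move=> k; rewrite !transp_funE; have [->|ka] := eqVneq k a.
  by rewrite eqxx; case: eqP.
by have [->|/negPf kb] := eqVneq k b; rewrite ?eqxx// (negPf ka) kb.
Qed.

Fact transp_subproof a b : fsinjectiveb (transp_fun a b).
Proof. exact/fsinjectiveP/inv_inj/transp_funK. Qed.

Definition transp a b : sinf := SInf (transp_subproof a b).

Definition simple k : sinf := transp k k.+1.

Lemma simple_gen (w : sinf) : exists s : seq nat, \prod_(k <- s) simple k = w.
Proof.
suff gen n : forall w : sinf, (forall i, n <= i -> w i = i) ->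
    exists s : seq nat, \prod_(k <- s) simple k = w.
  apply: (gen (\max_(i <- finsupp w) i).+1 w) => i; apply: contraTeq => wi.
  have iw : i \in finsupp w by rewrite mem_finsupp.
  by rewrite -ltnNge ltnS; apply: leq_bigmax_seq.
elim: n => [|n IHn] {}w wfix.
  by exists [::]; rewrite big_nil; apply: sinfP => i; rewrite wfix// fsfun0E.
have wn : w n <= n.
  rewrite leqNgt; apply/negP => nw.
  by have /sinf_injective E := wfix _ nw; rewrite E ltnn in nw.
elim: {wn}(n - w n)%N {-2}w (subnKC wn) wfix => {w} [|d IHd] w.
  rewrite addn0 => wn wfix; apply: IHn => i; rewrite leq_eqVlt.
  by case/predU1P => [<-//|]; exact: wfix.
move=> wn wfix; have [||s sw] := IHd (simple (w n) * w).
- by rewrite mulsE transp_funE eqxx addSn -addnS.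
- move=> i ni; rewrite mulsE (wfix _ ni) transp_funE.
  have wi : w n < n by rewrite -{2}wn addnS ltnS leq_addr.
  by rewrite !gtn_eqF// (leq_ltn_trans _ ni)// ltnW.
exists (w n :: s); rewrite big_cons sw mulgA -[RHS]mul1g; congr (_ * _).
by apply: sinfP => i; rewrite mulsE fsfun0E; exact: transp_funK.
Qed.

Definition is_word_length (w : sinf) (n : nat) : Prop :=
  exists2 s : seq nat, \prod_(k <- s) simple k = w & size s = n.

Fact is_word_length_ex (w : sinf) : exists n, `[< is_word_length w n >].
Proof.
by have [s sw] := simple_gen w; exists (size s); apply/asboolP; exists s.
Qed.

Definition len (w : sinf) : nat := ex_minn (is_word_length_ex w).

Definition left_weak_step (u v : sinf) : Prop :=
  exists k, v = simple k * u /\ len v = (len u).+1.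

Definition left_weak_le : sinf -> sinf -> Prop :=
  clos_refl_trans sinf left_weak_step.

Definition bruhat_cover (w : sinf) (a b : nat) : Prop :=
  len (transp a b * w) = (len w).+1.

Definition pi_cover (pi w : sinf) (a b : nat) : Prop :=
  bruhat_cover w a b /\ left_weak_le (transp a b * w) pi.

(* Partitions are weakly decreasing sequences lam, extended by zeros beyond
   their size; trailing zeros are allowed. *)

Definition is_partition (lam : seq nat) : bool := sorted geq lam.

Definition in_diagram (w : sinf) (i j : nat) : bool :=
  (i < w^-1 j) && (j < w i).

(* pi = dom(lam) *)
Definition is_dominant (lam : seq nat) (pi : sinf) : Prop :=
  forall i j, in_diagram pi i j = (j < nth 0 lam i).

Local Open Scope classical_set_scope.

(* Pipe dreams are given by their crosses. They are read row by row from top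
   to bottom, each row from right to left; a cross in row i and column j
   (counted from 0) is read as the simple transposition of index i + j. *)

Definition reading_order (c d : nat * nat) : bool :=
  (c.1 < d.1) || (c.1 == d.1) && (d.2 <= c.2).

Definition reading_word (P : {fset nat * nat}) : seq nat :=
  [seq (c.1 + c.2)%N | c <- sort reading_order P].

Definition reduced_pipe_dreams (w : sinf) : set {fset nat * nat} :=
  [set P | \prod_(k <- reading_word P) simple k = w /\ #|` P|%fset = len w].

Local Open Scope ring_scope.

Definition pipe_weight (P : {fset nat * nat}) : {malg int[{cmonom nat}]} :=
  \prod_(c <- P) << ucm c.1 >>.

(* reduced_pipe_dreams w is finite: if w fixes every i >= n, the letters of its
   reduced words are < n - 1, so its crosses satisfy i + j < n - 1. *)
Definition schubert (w : sinf) : {malg int[{cmonom nat}]} :=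
  \sum_(P \in reduced_pipe_dreams w) pipe_weight P.

Notation polyxy := {malg int[{cmonom (nat + nat)%type}]}.

Definition xvar (i : nat) : polyxy := << ucm (inl i) >>.
Definition yvar (i : nat) : polyxy := << ucm (inr i) >>.

(* The monomial x^m contributes y^lam (x/y)^m = x^m y^(lam - m); the truncated
   subtraction is exact when x^m divides x^lam. *)
Definition padded_monom (lam : seq nat) (m : {cmonom nat}) : polyxy :=
  (\prod_(i <- finsupp m) xvar i ^+ m i) *
  (\prod_(i < size lam) yvar i ^+ (nth 0%N lam i - m i)%N).

Definition padded_schubert (lam : seq nat) (w : sinf) : polyxy :=
  \sum_(m <- msupp (schubert w)) (schubert w)@_m *: padded_monom lam m.

Definition pderiv (v : nat + nat) (p : polyxy) : polyxy :=
  \sum_(m <- msupp p) << p@_m *+ m v *g divcm m (ucm v) >>.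

(* Only finitely many terms are nonzero, since p involves finitely many y_i. *)
Definition Delta (p : polyxy) : polyxy :=
  \sum_(i \in [set: nat]) xvar i * pderiv (inr i) p.

Definition cover_A (w : sinf) (a b : nat) : set nat :=
  [set k | (b < k)%N /\ (w^-1%g a < w^-1%g k < w^-1%g b)%N].

Definition cover_B (pi w : sinf) (a b : nat) : set nat :=
  [set k | (b < k)%N /\
    ((pi * w^-1)%g b < (pi * w^-1)%g k < (pi * w^-1)%g a)%N].

(* fset_set sends infinite sets to fset0; cover_A and cover_B are always finite
   because w^-1 and pi * w^-1 are injective and their values are bounded on
   these sets. *)
Definition ncard (S : set nat) : nat := #|` fset_set S|%fset.

(* Main.v *)
From Stdlib Require Import Relation_Operators.
Require Import Defs.
From mathcomp Require Import all_boot all_order all_algebra finmap.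
From mathcomp Require Import boolp classical_sets cardinality fsbigop.
From mathcomp.multinomials Require Import monalg.
From mathcomp Require Import zify ring.

(** Why the theorem is true.

    On a monomial y^lambda (x/y)^m with m <= lambda, the operator Delta replaces
    a factor y_i by x_i, with multiplicity lambda_i - m_i. So on padded
    polynomials Delta is the padding of the first-order operator
      sum_i (lambda_i x_i - x_i^2 d/dx_i)
    [Delta_padded]. This applies to S_w because its monomials divide x^lambda
    when w is below dom(lambda): a cross in row i of a reduced pipe dream gives
    an inversion of w whose right end q satisfies pi(q) < lambda_i, and the
    crosses of one row have distinct right ends [dominant_row_bound].

    The action of such an operator on S_w is known for every permutation and
    every finitely supported sequence c [schubert_raising]:
      (sum_i c_i x_i + sum_i x_i^2 d/dx_i) S_w
        = sum over covers w < w t_ij of (c_i - c_j + d(w;i,j)) S_{w t_ij},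
    where d(w;i,j) counts the p strictly between i and j, with sign + if
    w(p) < w(i) and sign - if w(p) > w(j). It contains Monk's rule. The proof is
    by induction on the length of w. Let sigma_k exchange x_k and x_{k+1}. The
    divided difference recursion says
      sigma_k S_w = S_w - (x_k - x_{k+1}) S_{w s_k}
    if k is a descent of w, and sigma_k S_w = S_w otherwise [sigma_schubert].
    Hence the difference of the two sides changes under sigma_k by
    (x_k - x_{k+1}) times the same identity for w s_k, in which c is replaced by
    c s_k + e_k + e_{k+1}; the two unit vectors come from
    x_k^2 - x_{k+1}^2 = (x_k - x_{k+1}) (x_k + x_{k+1}). By induction the
    difference is fixed by every sigma_k. It has no constant term, and a
    polynomial in finitely many of infinitely many variables that is fixed by
    every sigma_k is constant, so it vanishes.

    The recursion follows from the definition by pipe dreams through the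
    nilCoxeter algebra, with generators u_k, as in the work of Fomin and
    Stanley. The sum over pipe dreams is the expansion of an ordered product of
    factors 1 + x_i u_k, the row of index k being
      A_k(x) = (1 + x u_{N-1}) ... (1 + x u_{k+1}) (1 + x u_k),
    and the braid relations give A_k(x) A_k(y) = A_k(y) A_k(x)
    [nil_row_comm], which is the recursion in disguise [nil_row_swap].

    It remains to read the coefficient for c = - lambda when w is below
    pi = dom(lambda) [cover_coef_dominant]. Left weak order is containment of
    inversions, so w t_ij is below pi exactly when pi(j) < pi(i). Since lambda_i
    is the number of p with pi(p) < lambda_i, the coefficient is a sum over p,
    and a comparison for each p gives 1 + |A| + |B| if pi(j) < pi(i) and 0
    otherwise. *)

Set Implicit Arguments.
Unset Strict Implicit.
Unset Printing Implicit Defensive.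

Import GRing.Theory.

Local Notation Pol := {malg int[{cmonom nat}]}.
Local Notation Xv i := (<< ucm (i : nat) >>%R : Pol).

(** * Length, covers and left weak order *)

Section Permutations.
Local Open Scope group_scope.
Implicit Types (u v w : sinf) (i j k p q : nat).

Lemma sinf1E i : (1 : sinf) i = i.
Proof. exact: fsfun0E. Qed.

Lemma sinfKV w : cancel w^-1 w.
Proof. by move=> i; rewrite -mulsE mulgV sinf1E. Qed.

Lemma sinfVK w : cancel w w^-1.
Proof. by move=> i; rewrite -mulsE mulVg sinf1E. Qed.

Lemma sinf_eq w i j : (w i == w j) = (i == j).
Proof. exact: inj_eq (@sinf_injective w) i j. Qed.

Lemma sinf_bound w : exists N, forall i, (N <= i) -> w i = i.
Proof.
exists (\max_(i <- finsupp w) i).+1 => i; apply: contraTeq => wi.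
have iw : i \in finsupp w by rewrite mem_finsupp.
by rewrite -ltnNge ltnS; apply: leq_bigmax_seq.
Qed.

Lemma transpE a b k :
  transp a b k = if k == a then b else if k == b then a else k.
Proof. exact: transp_funE. Qed.

Lemma transpC a b : transp a b = transp b a.
Proof.
apply: sinfP => k; rewrite !transpE.
by case: eqP => [->|]; case: eqP => // ->.
Qed.

Lemma transpK a b : transp a b * transp a b = 1.
Proof. by apply: sinfP => k; rewrite mulsE sinf1E; exact: transp_funK. Qed.

Lemma transp_mul w i j : transp (w i) (w j) * w = w * transp i j.
Proof.
apply: sinfP => k; rewrite !mulsE !transpE !sinf_eq.
by case: eqP => // _; case: eqP.
Qed.

Lemma simpleE k i :
  simple k i = if i == k then k.+1 else if i == k.+1 then k else i.
Proof. exact: transpE. Qed.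

Lemma simpleK k : simple k * simple k = 1.
Proof. exact: transpK. Qed.

Lemma simple_invK k : involutive (simple k).
Proof. exact: transp_funK. Qed.

Lemma len_word (s : seq nat) : len (\prod_(k <- s) simple k) <= size s.
Proof.
rewrite /len; case: ex_minnP => n _; apply; apply/asboolP; by exists s.
Qed.

Lemma len_reduced w : exists2 s : seq nat, \prod_(k <- s) simple k = w &
  size s = len w.
Proof. by rewrite /len; case: ex_minnP => n /asboolP[s]; exists s. Qed.

Lemma len1 : len 1 = 0.
Proof. by apply/eqP; have := len_word [::]; rewrite big_nil leqn0. Qed.

Lemma len_mulsl k w : len (simple k * w) <= (len w).+1.
Proof.
by have [s <- <-] := len_reduced w; have := len_word (k :: s); rewrite big_cons.
Qed.

Lemma len_mulsr k w : len (w * simple k) <= (len w).+1.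
Proof.
have [s <- <-] := len_reduced w.
by have := len_word (rcons s k); rewrite big_rcons size_rcons.
Qed.

Lemma len_le_mulsl k w : len w <= (len (simple k * w)).+1.
Proof. by have := len_mulsl k (simple k * w); rewrite mulgA simpleK mul1g. Qed.

Lemma len_le_mulsr k w : len w <= (len (w * simple k)).+1.
Proof. by have := len_mulsr k (w * simple k); rewrite -mulgA simpleK mulg1. Qed.

(** The strong exchange property. Follow the images of i and j through the
    letters, from right to left: the letter at which they change order exchanges
    exactly these two images, so multiplying by t_ij deletes it. *)
Lemma word_exchange (s : seq nat) i j (w := \prod_(k <- s) simple k) :
    i < j -> w j < w i ->
  exists2 s' : seq nat, \prod_(k <- s') simple k = w * transp i j &
    (size s').+1 = size s.
Proof.
rewrite {}/w => ij; elim: s => [|a s IH].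
  by rewrite big_nil !sinf1E ltnNge ltnW.
rewrite big_cons; set y := \prod_(k <- s) simple k in IH *.
case: (ltngtP (y i) (y j)) => [yij|yji|]; last first.
- by move/sinf_injective => E; rewrite E ltnn in ij.
- by move=> _; have [s' Hs' sz] := IH yji; exists (a :: s'); rewrite /= ?sz // big_cons Hs' mulgA.
rewrite !mulsE => H; exists s; last by [].
have [yi yj] : y i = a /\ y j = a.+1.
  move: (y i) (y j) yij H => m n; rewrite !simpleE.
  by repeat case: eqP; lia.
by rewrite -/y /simple -yj -yi transp_mul -mulgA transpK mulg1.
Qed.

Lemma len_transp_lt w i j : i < j -> w j < w i -> len (w * transp i j) < len w.
Proof.
move=> ij; have [s ws <-] := len_reduced w; rewrite -ws.
by move=> /(word_exchange ij)[s' <- <-]; exact: len_word.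
Qed.

Lemma len_transp_gt w i j : i < j -> w i < w j -> len w < len (w * transp i j).
Proof.
move=> ij wij; have := @len_transp_lt (w * transp i j) i j ij.
rewrite -mulgA transpK mulg1; apply; rewrite !mulsE !transpE !eqxx.
by rewrite gtn_eqF.
Qed.

Definition descent w k := w k.+1 < w k.

Lemma len_descent w k : descent w k -> len w = (len (w * simple k)).+1.
Proof.
move=> wk; apply/eqP; rewrite eqn_leq len_le_mulsr /=.
exact: len_transp_lt.
Qed.

Lemma len_ascent w k : ~~ descent w k -> len (w * simple k) = (len w).+1.
Proof.
move=> wk; apply/eqP; rewrite eqn_leq len_mulsr /=; apply: len_transp_gt => //.
by have := sinf_eq w k k.+1; move: wk; rewrite /descent; lia.
Qed.

Lemma descentP w k : descent w k = (len w == (len (w * simple k)).+1).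
Proof.
by case: (boolP (descent w k)) => [/len_descent->|/len_ascent->]; rewrite ?eqxx//; lia.
Qed.

Lemma simple_mul w k : simple k * w = w * transp (w^-1 k) (w^-1 k.+1).
Proof. by rewrite -transp_mul !sinfKV. Qed.

(** Left multiplication by s_k exchanges the positions of the values k and
    k + 1, so it is also a right multiplication by a transposition. *)
Lemma left_ascentP w k : (w^-1 k < w^-1 k.+1) = (len (simple k * w) == (len w).+1).
Proof.
rewrite simple_mul; set p := w^-1 k; set q := w^-1 k.+1.
have [wp wq] : w p = k /\ w q = k.+1 by rewrite !sinfKV.
case: (ltngtP p q) => [pq|qp|pq].
- apply/esym/eqP/anti_leq; rewrite [X in _ && X]len_transp_gt ?wp ?wq// andbT.
  by rewrite -simple_mul len_mulsl.
- by have := @len_transp_lt w q p qp; rewrite transpC wp wq; lia.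
- by have := sinf_eq w p q; rewrite wp wq pq; lia.
Qed.

Definition is_cover w i j := (i < j) && (len (w * transp i j) == (len w).+1).

Lemma cover_lt w i j : is_cover w i j -> i < j /\ w i < w j.
Proof.
case/andP => ij /eqP wl; split=> //; have := len_transp_lt ij (w := w).
by have := sinf_eq w i j; lia.
Qed.

(** If w p lay between w i and w j, three transpositions, each of them raising
    the length, would lead from w to w t_ij. *)
Lemma cover_between w i j p : is_cover w i j -> i < p < j ->
  (w p < w i) || (w j < w p).
Proof.
move=> cij /andP[ip pj]; have [ij wij] := cover_lt cij.
have nip := sinf_eq w i p; have njp := sinf_eq w j p.
rewrite leqNgt -ltnNge; apply/negPn/negP; rewrite negb_or -!ltnNge => /andP[lip lpj].
move/andP: cij => [_ /eqP]; suff: (len w).+2 < len (w * transp i j) by lia.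
have E : w * transp i j = w * transp i p * transp p j * transp i p.
  apply: sinfP => k; rewrite !mulsE !transpE; congr (w _).
  by repeat case: eqP => //=; lia.
(* With values a < m < b at i < p < j, the orders are a m b, m a b, m b a, b m a. *)
have l1 : len w < len (w * transp i p) by apply: len_transp_gt; lia.
have l2 : len (w * transp i p) < len (w * transp i p * transp p j).
  apply: len_transp_gt => //; rewrite !mulsE !transpE.
  by repeat case: eqP => //=; try lia.
have l3 : len (w * transp i p * transp p j) < len (w * transp i j).
  rewrite E; apply: len_transp_gt => //; rewrite !mulsE !transpE.
  by repeat case: eqP => //=; try lia.
lia.
Qed.

Definition inversions_sub w v := forall i j, i < j -> w j < w i -> v j < v i.

(** Only the positions of k and k + 1 change order in the step to s_k w. *)
Lemma left_weak_inversions w v : left_weak_le w v -> inversions_sub w v.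
Proof.
elim=> {w v} [w _ [k [-> wl]]|w i j|w x v _ IH1 _ IH2 i j ij].
- move=> i j ij wji; move/eqP: wl; rewrite -left_ascentP !mulsE !simpleE => H.
  have nij : ~ (w j = k /\ w i = k.+1).
    by case=> wj wi; move: H; rewrite -wi -wj !sinfVK; lia.
  by repeat case: eqP; lia.
- by [].
- by move=> /(IH1 _ _ ij)/(IH2 _ _ ij).
Qed.

Lemma sinf_lt_id w : (forall k, w k < w k.+1) -> w = 1.
Proof.
move=> wlt; have mono : {homo w : i j / i < j} by apply: homo_ltn => //; exact: ltn_trans.
have ge i : i <= w i.
  by elim: i => // i IH; exact: leq_ltn_trans IH (wlt i).
have monoV : {homo w^-1 : i j / i < j}.
  move=> i j ij; rewrite ltnNge; apply/negP.
  rewrite leq_eqVlt => /orP[/eqP/sinf_injective E|/mono]; first by rewrite E ltnn in ij.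
  by rewrite !sinfKV; lia.
have geV i : i <= w^-1 i.
  by elim: i => // i IH; apply: leq_ltn_trans IH _; apply: monoV.
apply: sinfP => i; rewrite sinf1E; apply/anti_leq; rewrite ge andbT.
by rewrite -{2}(sinfVK w i) geV.
Qed.

(** If w differs from v, then v w^-1 has a descent k. The positions of k and
    k + 1 in w form an inversion of v that w lacks; hence s_k w is one step above
    w, its inversions are still inversions of v, and v (s_k w)^-1 is shorter. *)
Lemma inversions_left_weak w v : inversions_sub w v -> left_weak_le w v.
Proof.
have [n ln] := ubnP (len (v * w^-1)); elim: n w ln => [//|n IH] w ln sub.
case: (pselect (forall k, ~~ descent (v * w^-1) k)) => [asc|/existsNP[k /negP/negPn dk]].
  have E : v * w^-1 = 1.
    apply: sinf_lt_id => k; have := asc k; rewrite /descent.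
    by have := sinf_eq (v * w^-1) k k.+1; lia.
  by move/(congr1 (fun z => z * w)): E; rewrite mulgVK mul1g => ->; exact: rt_refl.
have pq : w^-1 k < w^-1 k.+1.
  move: dk; rewrite /descent !mulsE => dk.
  case: (ltngtP (w^-1 k) (w^-1 k.+1)) => // [qp|/sinf_injective]; last by lia.
  by have := sub _ _ qp; rewrite !sinfKV; lia.
apply: (rt_trans _ _ _ (simple k * w)).
  by apply: rt_step; exists k; split=> //; apply/eqP; rewrite -left_ascentP.
apply: IH.
  have := len_descent dk; rewrite invgM.
  have -> : (simple k)^-1 = simple k by rewrite -[LHS]mul1g -(simpleK k) mulgK.
  by rewrite mulgA => E; rewrite -ltnS -E.
move=> i j ij; rewrite !mulsE => H.
case: (ltnP (w j) (w i)) => [/(sub _ _ ij)//|wij].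
have [wi wj] : w i = k /\ w j = k.+1.
  have := sinf_eq w i j; move: wij H; rewrite !simpleE.
  move: (w i) (w j) => m l; repeat case: eqP; lia.
by move: dk; rewrite /descent -wj -wi !mulsE !sinfVK.
Qed.

End Permutations.

(** * The nilCoxeter algebra *)

Section NilCoxeter.
Variable R : comNzRingType.
Local Open Scope ring_scope.
Implicit Types (F G : sinf -> R) (w : sinf) (k j d : nat) (x y : R).

(** Left multiplication by the generator u_k of the nilCoxeter algebra, where
    u_k u_v is u_(s_k v) if the length grows and 0 otherwise. An element
    sum_w F(w) u_w is represented by its coefficients F. *)
Definition nilc k F : sinf -> R := fun w =>
  if len w == (len (simple k * w)%g).+1 then F (simple k * w)%g else 0.

(** Left multiplication by 1 + x u_k. *)
Definition nilh k x F : sinf -> R := fun w => F w + x * nilc k F w.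

Lemma nilcD k F G x w :
  nilc k (fun v => F v + x * G v) w = nilc k F w + x * nilc k G w.
Proof. by rewrite /nilc; case: ifP => // _; rewrite mulr0 addr0. Qed.

(** Both steps lower the length exactly if together they lower it by two. *)
Lemma nilc2 j k F w : nilc j (nilc k F) w =
  if len w == (len (simple k * (simple j * w))%g).+2 then
    F (simple k * (simple j * w))%g else 0.
Proof.
rewrite /nilc; have := len_le_mulsl j w; have := len_le_mulsl k (simple j * w)%g.
by repeat case: eqP => //; lia.
Qed.

Lemma nilcc k F : nilc k (nilc k F) = fun=> 0.
Proof.
apply: funext => w; rewrite nilc2 mulgA simpleK mul1g; case: eqP => //; lia.
Qed.

Lemma nilc_comm j k F : (j.+1 < k)%N -> nilc j (nilc k F) = nilc k (nilc j F).
Proof.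
move=> jk; apply: funext => w; rewrite !nilc2 !mulgA.
suff -> : (simple k * simple j = simple j * simple k)%g by [].
apply: sinfP => i; rewrite !mulsE !simpleE.
by repeat case: eqP; lia.
Qed.

Lemma nilc_braid k F :
  nilc k (nilc k.+1 (nilc k F)) = nilc k.+1 (nilc k (nilc k.+1 F)).
Proof.
apply: funext => w; rewrite !nilc2 /nilc.
have E : (simple k * (simple k.+1 * (simple k * w)) =
          simple k.+1 * (simple k * (simple k.+1 * w)))%g.
  apply: sinfP => i; rewrite !mulsE !simpleE; move: (w i) => {}i.
  by repeat case: eqP; lia.
have := len_le_mulsl k (simple k.+1 * (simple k * w))%g.
have := len_le_mulsl k.+1 (simple k * w)%g.
have := len_le_mulsl k w.
have := len_le_mulsl k.+1 (simple k * (simple k.+1 * w))%g.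
have := len_le_mulsl k (simple k.+1 * w)%g.
have := len_le_mulsl k.+1 w; rewrite E.
by repeat case: eqP => //; lia.
Qed.

Lemma nilhD k y F G x :
  nilh k y (fun v => F v + x * G v) = fun w => nilh k y F w + x * nilh k y G w.
Proof. by apply: funext => w; rewrite /nilh nilcD; ring. Qed.

Lemma nilh_add k x y F : nilh k x (nilh k y F) = nilh k (x + y) F.
Proof. by apply: funext => w; rewrite /nilh nilcD nilcc; ring. Qed.

Lemma nilh_comm j k x y F : (j.+1 < k)%N ->
  nilh j x (nilh k y F) = nilh k y (nilh j x F).
Proof.
by move=> jk; apply: funext => w; rewrite /nilh !nilcD (nilc_comm _ jk); ring.
Qed.

(** Left multiplication by
    (1 - y u_(k+1)) (1 + x u_k) (1 + y u_(k+1)) (1 + y u_k), in the expanded form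
    that shows it to be symmetric in x and y. *)
Definition nil_yb k x y F : sinf -> R := fun w =>
  F w + (x + y) * nilc k F w +
  x * y * (nilc k (nilc k.+1 F) w - nilc k.+1 (nilc k F) w).

Lemma nil_ybC k x y F : nil_yb k x y F = nil_yb k y x F.
Proof. by apply: funext => w; rewrite /nil_yb; ring. Qed.

(** A form of the Yang-Baxter equation
    h_k(x) h_(k+1)(x + y) h_k(y) = h_(k+1)(y) h_k(x + y) h_(k+1)(x) for the
    factors h_k(x) = 1 + x u_k. *)
Lemma nilh_yang_baxter k x y F :
  nilh k x (nilh k.+1 y (nilh k y F)) = nilh k.+1 y (nil_yb k x y F).
Proof.
apply: funext => w; rewrite /nil_yb /nilh !nilcD.
have -> : (fun v => F v + y * nilc k F v) = nilh k y F by [].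
have E c I J : nilc c (fun v => I v - J v) w = nilc c I w - nilc c J w :> R.
  by rewrite /nilc; case: ifP => _; ring.
rewrite !E.
have D c c' G H x' : nilc c (nilc c' (fun v => G v + x' * H v)) w =
   nilc c (nilc c' G) w + x' * nilc c (nilc c' H) w :> R.
  by rewrite !nilc2; case: ifP => _; ring.
by rewrite /nilh !D nilcc nilc_braid nilcc; ring.
Qed.

(** The factor A_k(x) of one row. The crosses of a row are read from right to
    left, that is with decreasing letters. *)
Definition nil_row d k x F := foldr (fun a => nilh a x) F (rev (iota k d)).

Lemma nil_rowS d k x F : nil_row d.+1 k x F = nil_row d k.+1 x (nilh k x F).
Proof. by rewrite /nil_row /= rev_cons foldr_rcons. Qed.

Lemma nil_rowD d k y F G x :
  nil_row d k y (fun v => F v + x * G v) =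
  fun w => nil_row d k y F w + x * nil_row d k y G w.
Proof. by elim: d k F G => //= d IH k F G; rewrite !nil_rowS nilhD IH. Qed.

Lemma nilh_row_comm d j k x y F : (j.+1 < k)%N ->
  nilh j x (nil_row d k y F) = nil_row d k y (nilh j x F).
Proof.
elim: d k F => //= d IH k F jk; rewrite !nil_rowS IH ?(ltn_trans jk)//.
by rewrite nilh_comm.
Qed.

(** Induction on the number of letters, in the product A_k(x) A_k(y). The factor
    1 + x u_k moves past the letters k + 2, ... of A_k(y) and meets
    (1 + y u_(k+1)) (1 + y u_k). These three factors are 1 + y u_(k+1) times an
    expression symmetric in x and y, and the former completes
    A_(k+1)(x) A_(k+1)(y). *)
Lemma nil_row_comm d k x y F :
  nil_row d k x (nil_row d k y F) = nil_row d k y (nil_row d k x F).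
Proof.
elim: d k F => // -[|d] IH k F.
  by rewrite /nil_row /= !nilh_add addrC.
have step a b : nil_row d.+2 k a (nil_row d.+2 k b F) =
    nil_row d.+1 k.+1 a (nil_row d k.+2 b (nilh k a (nilh k.+1 b (nilh k b F)))).
  by rewrite !(nil_rowS d.+1) (nil_rowS d k.+1 b) nilh_row_comm.
rewrite !step.
by rewrite !nilh_yang_baxter -!nil_rowS nil_ybC IH.
Qed.

(** The product A_k(x) A_(k+1)(y) (1 + y u_k) = A_k(x) A_k(y) is symmetric in x
    and y. Since (1 + x u_k) (1 - y u_k) = 1 + (x - y) u_k, moving the last factor
    to the other side compares A_k(x) A_(k+1)(y) with A_k(y) A_(k+1)(x). *)
Lemma nil_row_swap d k x y F :
  nil_row d.+1 k y (nil_row d k.+1 x F) =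
  nil_row d.+1 k x (nil_row d k.+1 y (nilh k (y - x) F)).
Proof.
have {1}-> : F = nilh k x (nilh k (- x) F).
  by rewrite nilh_add subrr; apply: funext => w; rewrite /nilh mul0r addr0.
by rewrite -nil_rowS nil_row_comm (nil_rowS d k y) nilh_add.
Qed.

(** The rows k, ..., k + d - 1 of a staircase, whose letters are smaller than
    k + d. *)
Fixpoint nil_rows d k (x : nat -> R) F :=
  if d is d'.+1 then nil_row d k (x k) (nil_rows d' k.+1 x F) else F.

Lemma nilh_rows_comm d j k (x : nat -> R) y F : (j.+1 < k)%N ->
  nilh j y (nil_rows d k x F) = nil_rows d k x (nilh j y F).
Proof.
elim: d k F => [//|d IH] k F jk /=.
by rewrite nilh_row_comm // IH // ltnW.
Qed.

Lemma eq_nil_rows d k (x y : nat -> R) F :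
  (forall i, (k <= i)%N -> x i = y i) -> nil_rows d k x F = nil_rows d k y F.
Proof.
elim: d k => //= d IH k xy; rewrite xy// (IH k.+1)// => i /ltnW; exact: xy.
Qed.

(** Only rows j and j + 1 see the exchange of variables, and the correcting
    factor commutes with the rows after them, whose letters exceed j + 1. *)
Lemma nil_rows_swap d k j (x : nat -> R) F : (k <= j)%N -> (j.+1 < k + d)%N ->
  nil_rows d k (fun i => x (simple j i)) F =
  nil_rows d k x (nilh j (x j.+1 - x j) F).
Proof.
elim: d k => [|d IH] k; first by lia.
rewrite leq_eqVlt => /predU1P[-> {k}|kj] jd.
  case: d IH jd => [|d] _ jd; first by lia.
  rewrite /= !simpleE eqxx (gtn_eqF (ltnSn j)) eqxx nil_row_swap.
  rewrite (@eq_nil_rows _ _ _ x); last first.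
    by move=> i ji; rewrite simpleE !gtn_eqF// ltnW.
  by rewrite nilh_rows_comm.
rewrite /= IH//; last by lia.
by rewrite simpleE !ltn_eqF// ltnW.
Qed.

(** Right multiplication by u_k. It commutes with left multiplications, so a
    factor u_k at the right end of a product of rows, next to the unit, can be
    pulled out of the product. *)
Definition rnilc k F : sinf -> R := fun w =>
  if len w == (len (w * simple k)%g).+1 then F (w * simple k)%g else 0.

Lemma rnilc_nilc j k F : nilc k (rnilc j F) = rnilc j (nilc k F).
Proof.
apply: funext => w; rewrite /nilc /rnilc.
have A : (simple k * (w * simple j) = simple k * w * simple j)%g by rewrite mulgA.
have := len_le_mulsl k w; have := len_le_mulsl k (w * simple j)%g; rewrite !A.
have := len_le_mulsr j w; have := len_le_mulsr j (simple k * w)%g.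
by repeat case: eqP => //; lia.
Qed.

Lemma rnilc_nilh j k x F : nilh k x (rnilc j F) = rnilc j (nilh k x F).
Proof.
apply: funext => w; rewrite /nilh rnilc_nilc /rnilc.
by case: ifP; rewrite ?mulr0 ?addr0.
Qed.

Lemma rnilc_rows d k j (x : nat -> R) F : nil_rows d k x (rnilc j F) = rnilc j (nil_rows d k x F).
Proof.
elim: d k F => //= d IH k F; rewrite IH /nil_row.
by elim: (rev _) => //= a s ->; rewrite rnilc_nilh.
Qed.

Lemma nil_rowsD d k (x : nat -> R) F G c :
  nil_rows d k x (fun w => F w + c * G w) =
  fun w => nil_rows d k x F w + c * nil_rows d k x G w.
Proof. by elim: d k => //= d IH k; rewrite IH nil_rowD. Qed.

(** The unit of the nilCoxeter algebra. *)
Definition sinf_delta : sinf -> R := fun w => (w == 1%g)%:R.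

Lemma nilc_delta j : nilc j sinf_delta = rnilc j sinf_delta.
Proof.
apply: funext => w; rewrite /nilc /rnilc /sinf_delta.
have E : (simple j * w == 1 :> sinf)%g = (w * simple j == 1 :> sinf)%g.
  by apply/eqP/eqP => H; [rewrite -[LHS]mul1g -(simpleK j)|rewrite -[LHS]mulg1 -(simpleK j)];
   [rewrite -mulgA (mulgA _ w) H mul1g simpleK|rewrite mulgA -(mulgA _ w) H mulg1 simpleK].
rewrite E; case: (boolP (w * simple j == 1)%g) => [H|]; last by rewrite !if_same.
by rewrite (eqP H); move: H; rewrite -E => /eqP ->.
Qed.

(** The coefficient of u_w in the product of the rows of a staircase. The
    variables x are arbitrary ring elements, which makes it possible to permute
    them. *)
Definition sch N (x : nat -> R) : sinf -> R := nil_rows N 0 x sinf_delta.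

Lemma sch_swap N (x : nat -> R) k w : (k.+1 < N)%N ->
  sch N (fun i => x (simple k i)) w =
  sch N x w - (x k - x k.+1) * (if descent w k then sch N x (w * simple k)%g else 0).
Proof.
move=> kN; rewrite /sch nil_rows_swap // nil_rowsD nilc_delta rnilc_rows /rnilc descentP.
ring.
Qed.

Fixpoint subseqs (T : Type) (s : seq T) : seq (seq T) :=
  if s is a :: s' then subseqs s' ++ [seq a :: t | t <- subseqs s'] else [:: [::]].

(** A product of generators is u_w if its letters form a reduced word of w, and
    0 if they form a word that is not reduced. *)
Lemma nilc_word_delta (s : seq nat) w :
  foldr nilc sinf_delta s w =
  ((\prod_(k <- s) simple k == w)%g && (size s == len w))%:R.
Proof.
elim: s w => [|k s IH] w /=.
  rewrite big_nil /sinf_delta eq_sym; case: eqP => [<-|//].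
  by rewrite len1.
rewrite /nilc IH big_cons; set v := (\prod_(i <- s) _)%g.
have E : (v == simple k * w)%g = (simple k * v == w)%g.
  by apply/eqP/eqP => [->|<-]; rewrite mulgA simpleK mul1g.
rewrite E; case: (boolP (simple k * v == w)%g) => [/eqP H|_]; last by case: ifP.
have lv : (len v <= size s)%N by exact: len_word.
have sv : (simple k * w)%g = v by rewrite -H mulgA simpleK mul1g.
have := len_le_mulsl k w; rewrite sv.
by repeat case: eqP => //=; lia.
Qed.

(** Expanding a product of factors 1 + x u_k means to decide for each cell
    whether it carries a cross. *)
Lemma cells_expand (x : nat -> R) (C : seq (nat * nat)) F w :
  foldr (fun c => nilh (c.1 + c.2)%N (x c.1)) F C w =
  \sum_(Q <- subseqs C) (\prod_(c <- Q) x c.1) *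
     foldr nilc F [seq (c.1 + c.2)%N | c <- Q] w.
Proof.
elim: C w => [|c C IH] w /=; first by rewrite big_seq1 big_nil mul1r.
rewrite big_cat big_map /=; rewrite /nilh IH; congr (_ + _).
rewrite /nilc IH; case: ifP => _.
  by rewrite mulr_sumr; apply: eq_bigr => Q _; rewrite big_cons mulrA.
by rewrite mulr0 big1 // => Q _; rewrite mulr0.
Qed.

End NilCoxeter.

(** * Pipe dreams and reduced words *)

Section Staircase.

(** Cells are listed in reading order, so that a pipe dream in the staircase is
    a subsequence. *)
Fixpoint stair d k : seq (nat * nat) :=
  if d is d'.+1 then [seq (k, c) | c <- rev (iota 0 d)] ++ stair d' k.+1 else [::].

Lemma nil_rows_stair (R : comNzRingType) d k (x : nat -> R) F :
  nil_rows d k x F = foldr (fun c => nilh (c.1 + c.2)%N (x c.1)) F (stair d k).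
Proof.
elim: d k => // d IH k.
rewrite [LHS]/= [stair _ _]/= foldr_cat -IH /nil_row.
have -> : iota k d.+1 = map (addn k) (iota 0 d.+1) by rewrite -iotaDl addn0.
by rewrite -map_rev !foldr_map.
Qed.

Lemma mem_stair d k c : (c \in stair d k) = (k <= c.1) && (c.1 + c.2 < k + d).
Proof.
case: c => i j; elim: d k => [|d IH] k.
  by rewrite in_nil /=; lia.
rewrite mem_cat IH /=.
have -> : ((i, j) \in [seq (k, c) | c <- rev (iota 0 d.+1)]) = (i == k) && (j < d.+1).
  apply/mapP/andP => [[c]|[/eqP -> jd]].
    by rewrite mem_rev mem_iota => cd [-> ->]; rewrite eqxx.
  by exists j; rewrite ?mem_rev ?mem_iota.
lia.
Qed.

Lemma reading_order_trans : transitive reading_order.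
Proof. by move=> [a b] [c d] [e f]; rewrite /reading_order /=; lia. Qed.
Lemma reading_order_anti : antisymmetric reading_order.
Proof.
move=> [a b] [c d]; rewrite /reading_order /= => H.
by apply/eqP; rewrite xpair_eqE; lia.
Qed.
Lemma reading_order_total : total reading_order.
Proof. by move=> [a b] [c d]; rewrite /reading_order /=; lia. Qed.

Lemma stair_sorted d k : sorted reading_order (stair d k).
Proof.
elim: d k => // d IH k.
rewrite (sorted_pairwise reading_order_trans) pairwise_cat.
rewrite -!(sorted_pairwise reading_order_trans) IH andbT; apply/andP; split.
  apply/allrelP => c e /mapP[j _ ->]; rewrite mem_stair /reading_order /=; lia.
rewrite sorted_map rev_sorted.
have := iota_ltn_sorted 0 d.+1; apply: sub_sorted => a b /=.
by rewrite /reading_order /= ltnn eqxx /=; lia.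
Qed.

Lemma stair_uniq d k : uniq (stair d k).
Proof.
elim: d k => // d IH k; rewrite cat_uniq IH andbT; apply/andP; split.
  by rewrite map_inj_uniq ?rev_uniq ?iota_uniq // => a b [].
by apply/hasPn => c; rewrite mem_stair => /andP[kc _]; apply/mapP => -[j _ E]; move: kc; rewrite E ltnn.
Qed.

End Staircase.

Section ReducedWords.
Local Open Scope group_scope.
Implicit Types (u v w : sinf) (s x y : seq nat).

Notation wprod s := (\prod_(k <- s) simple k).

Lemma len_word_mul x u : len (wprod x * u) <= size x + len u.
Proof.
by have [s <- <-] := len_reduced u; rewrite -big_cat -size_cat; exact: len_word.
Qed.

Lemma word_fixes s i : all (fun k => i != k) s -> all (fun k => i != k.+1) s ->
  wprod s i = i.
Proof.
elim: s => [|k s IH] /=; first by rewrite big_nil sinf1E.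
move=> /andP[ik /IH{}IH] /andP[ik1 /IH{}IH]; rewrite big_cons mulsE IH simpleE.
by rewrite (negPf ik) (negPf ik1).
Qed.

(** Deleting the letter a means exchanging two positions, and it shortens the
    word. If the values of w at these positions were in order, the exchange would
    make w longer. *)
Lemma reduced_word_inversion x a y (w := wprod (x ++ a :: y)) (v := wprod y) :
    size (x ++ a :: y) = len w ->
  v^-1 a < v^-1 a.+1 /\ w (v^-1 a.+1) < w (v^-1 a).
Proof.
move=> red; have wE : w = wprod x * (simple a * v) by rewrite /w big_cat big_cons.
have lv : len v <= size y by exact: len_word.
have lw : len w <= size x + len (simple a * v) by rewrite wE len_word_mul.
have pq : v^-1 a < v^-1 a.+1.
  rewrite left_ascentP; have := len_mulsl a v.
  by move: red lv lw; rewrite size_cat /=; move: (len _) (len v) (len _) => *; lia.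
split=> //; rewrite ltnNge leq_eqVlt; apply/norP; split.
  by rewrite sinf_eq neq_ltn pq.
apply/negP => /(len_transp_gt pq).
have -> : w * transp (v^-1 a) (v^-1 a.+1) = wprod (x ++ y).
  have E : v * transp (v^-1 a) (v^-1 a.+1) = simple a * v.
    by rewrite -transp_mul !sinfKV.
  by rewrite wE -mulgA -mulgA E (mulgA (simple a)) simpleK mul1g big_cat.
by move/leq_trans => /(_ _ (len_word _)); rewrite -red !size_cat /=; lia.
Qed.

(** Suppose that a is the rightmost letter with N <= a + 1. The letters to its
    right fix a + 1, so it creates an inversion of w with right end a + 1. But w
    fixes a + 1 and every larger value. *)
Lemma reduced_word_letters s N (w := wprod s) : size s = len w ->
  (forall i, N <= i -> w i = i) -> all (fun a => a.+1 < N) s.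
Proof.
move=> red wN; suff H x y : s = x ++ y -> all (fun a => a.+1 < N) y by exact: (H [::]).
elim: y x => //= a y IH x sE; have ally : all (fun a => a.+1 < N) y.
  by apply: (IH (rcons x a)); rewrite cat_rcons.
rewrite ally andbT ltnNge; apply/negP => Na.
have := @reduced_word_inversion x a y; rewrite -sE => /(_ red) [].
set v := wprod y; have vN i : N <= i -> v i = i.
  move=> Ni; apply: word_fixes; apply: sub_all ally => k; lia.
have -> : v^-1 a.+1 = a.+1 by rewrite -{1}(vN a.+1 Na) sinfVK.
rewrite -/w (wN _ Na) => H1 H2.
have /sinf_injective E := wN (w (v^-1 a)) (leq_trans Na (ltnW H2)).
by move: H2; rewrite E; lia.
Qed.

End ReducedWords.

Section Subsequences.
Variable T : eqType.
Implicit Types s t : seq T.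

Lemma mem_subseqs s t : (t \in subseqs s) = subseq t s.
Proof.
elim: s t => [|a s IH] t /=; first by rewrite inE; case: t.
rewrite mem_cat IH; case: t => [|b t].
  by rewrite sub0seq.
have [->|ab] := eqVneq b a.
  rewrite /= mem_map ?IH; last by move=> ? ? [].
  apply/orP/idP => [[H|//]|->]; last by right.
  exact: subseq_trans (subseq_cons t a) H.
rewrite /=; case: mapP => [[t' _ [E _]]|_]; last by rewrite orbF.
by rewrite E eqxx in ab.
Qed.

Lemma uniq_subseqs s : uniq s -> uniq (subseqs s).
Proof.
elim: s => //= a s IH /andP[as_ /IH us]; rewrite cat_uniq us /= map_inj_uniq ?us ?andbT.
  apply/hasPn => _ /mapP[t _ ->]; rewrite mem_subseqs; apply: contra as_.
  by move/mem_subseq => /(_ a); rewrite mem_head => ->.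
by move=> ? ? [].
Qed.

End Subsequences.

Section PipeDreams.
Local Open Scope fset_scope.
Implicit Types (P : {fset nat * nat}) (C Q : seq (nat * nat)) (w : sinf).

Lemma sort_seq_fset Q : uniq Q -> sorted reading_order Q ->
  sort reading_order (seq_fset tt Q) = Q.
Proof.
move=> uQ sQ; rewrite -[RHS](sorted_sort reading_order_trans sQ).
apply/(perm_sortP reading_order_total reading_order_trans reading_order_anti).
by have := seq_fset_perm tt Q; rewrite (undup_id uQ).
Qed.

Lemma seq_fset_sort P : seq_fset tt (sort reading_order P) = P.
Proof. by apply/fsetP => c; rewrite seq_fsetE mem_sort. Qed.

Lemma pipe_letter w N P c : (forall i, N <= i -> w i = i) ->
  reduced_pipe_dreams w P -> c \in P -> c.1 + c.2 < N.
Proof.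
move=> wN [wP sP] cP.
have: all (fun a => a.+1 < N) (reading_word P).
  apply: reduced_word_letters; rewrite ?wP //.
  by rewrite /reading_word size_map size_sort.
move/allP => /(_ (c.1 + c.2)%N) H; apply/ltnW/H.
by rewrite /reading_word; apply: map_f; rewrite mem_sort.
Qed.

Definition stair_dreams N w :=
  [seq Q <- subseqs (stair N 0) |
    ((\prod_(k <- [seq (c.1 + c.2)%N | c <- Q]) simple k)%g == w) && (size Q == len w)].

Lemma stair_dream_sort N Q : Q \in subseqs (stair N 0) ->
  sort reading_order (seq_fset tt Q) = Q.
Proof.
rewrite mem_subseqs => QC; apply: sort_seq_fset; first exact: subseq_uniq QC (stair_uniq _ _).
exact: (subseq_sorted reading_order_trans QC (stair_sorted _ _)).
Qed.

Local Open Scope ring_scope.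

(** The reduced pipe dreams of w lie in the staircase, and sorting identifies
    them with subsequences of it. *)
Lemma schubert_sum w N : (forall i, (N <= i)%N -> w i = i) ->
  schubert w = \sum_(Q <- stair_dreams N w) \prod_(c <- Q) Xv c.1.
Proof.
move=> wN; have memA Q : Q \in stair_dreams N w -> reduced_pipe_dreams w (seq_fset tt Q).
  rewrite mem_filter => /andP[/andP[/eqP wQ /eqP sQ] QC].
  split; first by rewrite /reading_word (stair_dream_sort QC).
  by rewrite -sQ -[in RHS](stair_dream_sort QC) size_sort.
rewrite /schubert (fsbigE (map (@seq_fset tt _) (stair_dreams N w))).
- rewrite big_map big_seq_cond [RHS]big_seq; apply: eq_big => Q.
    by apply: andb_idr => /memA ?; rewrite inE.
  case/andP; rewrite mem_filter => /andP[_ QC] _; rewrite /pipe_weight; apply: perm_big.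
  by rewrite -{2}(stair_dream_sort QC) perm_sym perm_sort.
- rewrite map_inj_in_uniq ?filter_uniq ?uniq_subseqs ?stair_uniq//.
  move=> Q Q'; rewrite !mem_filter => /andP[_ QC] /andP[_ QC'] E.
  by rewrite -(stair_dream_sort QC) E (stair_dream_sort QC').
- by move=> _ /= /mapP[Q /memA wQ ->].
- move=> P wP /negP[]; apply/mapP; exists (sort reading_order P); last by rewrite seq_fset_sort.
  rewrite mem_filter mem_subseqs; case: (wP) => wP1 wP2.
  rewrite -/(reading_word P) wP1 eqxx size_sort wP2 eqxx /=.
  suff -> : sort reading_order P = filter (mem P) (stair N 0) by exact: filter_subseq.
  rewrite -[RHS](sorted_sort reading_order_trans); last first.
    exact: (sorted_filter reading_order_trans) (stair_sorted _ _).
  apply/(perm_sortP reading_order_total reading_order_trans reading_order_anti).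
  apply: uniq_perm; rewrite ?fset_uniq ?filter_uniq ?stair_uniq// => c.
  rewrite mem_filter mem_stair /=; case: (boolP (c \in P)) => //= cP.
  by rewrite add0n (pipe_letter wN wP).
Qed.

Lemma sch_sum (R : comNzRingType) N (x : nat -> R) w :
  sch N x w = \sum_(Q <- stair_dreams N w) \prod_(c <- Q) x c.1.
Proof.
rewrite /sch nil_rows_stair cells_expand /stair_dreams.
rewrite [RHS]big_filter [RHS]big_mkcond; apply: eq_bigr => Q _.
by rewrite nilc_word_delta size_map; case: ifP; rewrite ?mulr1 ?mulr0.
Qed.

Lemma schubert_sch w N : (forall i, (N <= i)%N -> w i = i) ->
  schubert w = sch N (fun i => Xv i) w.
Proof. by move/schubert_sum ->; apply: esym; exact: sch_sum. Qed.

Lemma malgUM (I : choiceType) (m1 m2 : {cmonom I}) :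
  (<< m1 >> : {malg int[{cmonom I}]}) * << m2 >> = << mmul m1 m2 >>.
Proof. by rewrite malgM_def -[1 in RHS](mul1r 1); exact: fgmulUU. Qed.

Definition row_monom Q : {cmonom nat} := \big[mmul/mone]_(c <- Q) ucm c.1.

Lemma row_monomP Q : \prod_(c <- Q) Xv c.1 = << row_monom Q >>.
Proof.
rewrite /row_monom; elim: Q => [|c Q IH]; first by rewrite !big_nil.
by rewrite big_cons IH big_cons; exact: malgUM.
Qed.

Lemma row_monomE Q i : row_monom Q i = count (fun c => c.1 == i) Q.
Proof.
rewrite /row_monom; elim: Q => [|c Q IH]; first by rewrite big_nil cm1.
by rewrite big_cons cmM IH cmU.
Qed.

Lemma msupp_schubert w m : m \in msupp (schubert w) ->
  exists2 P, reduced_pipe_dreams w P & m = row_monom (sort reading_order P).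
Proof.
have [N wN] := sinf_bound w.
rewrite (schubert_sum wN) -mcoeff_neq0 raddf_sum /= => /eqP H.
have [Q] : exists2 Q, Q \in stair_dreams N w & row_monom Q = m.
  apply: contrapT => nQ; apply: H; rewrite big_seq big1 // => Q QC.
  rewrite row_monomP mcoeffU1; case: eqP => // E.
  by case: nQ; exists Q.
rewrite mem_filter => /andP[/andP[/eqP wQ /eqP sQ] QC] <-.
exists (seq_fset tt Q); last by rewrite (stair_dream_sort QC).
split; first by rewrite /reading_word (stair_dream_sort QC).
by rewrite -sQ -[in RHS](stair_dream_sort QC) size_sort.
Qed.

Lemma schubert_const w : w != 1%g -> (schubert w)@_(mone) = 0.
Proof.
move=> w1; apply/eqP; rewrite -[_ == 0]negbK mcoeff_neq0.
apply: contra w1 => /msupp_schubert[P [wP sP] /(congr1 mdeg)].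
rewrite mdeg1 /row_monom mdeg_prod => /esym/eqP.
rewrite sum_nat_seq_eq0 => /allP /= H; rewrite -wP.
suff -> : reading_word P = [::] by rewrite big_nil.
rewrite /reading_word; case E : (sort _ P) H => [//|c s] /(_ c).
by rewrite mem_head mdegU => /(_ isT).
Qed.

(** Let V be the product of the letters in row i and below. A cross c in row i,
    with letter a, creates an inversion (p, q) of w. The crosses of row i to the
    right of c have larger letters and do not move the value a, so q = V^-1 a
    determines c. Crosses read after c have letters at least i, so i <= p. Hence
    the crosses of row i give distinct values pi q below l. *)
Lemma schubert_bound (pi w : sinf) (i l : nat) (m : {cmonom nat}) :
  inversions_sub w pi ->
  (forall p q, (i <= p)%N -> (p < q)%N -> (pi q < pi p)%N -> (pi q < l)%N) ->
  m \in msupp (schubert w) -> (m i <= l)%N.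
Proof.
move=> wpi Hl /msupp_schubert[P [wP sP] ->]; rewrite row_monomE.
set Q := sort reading_order P.
have sQ : sorted reading_order Q by exact: sort_sorted reading_order_total _.
have uQ : uniq Q by rewrite sort_uniq fset_uniq.
pose wr := fun s : seq (nat * nat) => (\prod_(k <- [seq (c.1 + c.2)%N | c <- s]) simple k)%g.
pose V := wr [seq c <- Q | (i <= c.1)%N].
(* The value of pi at the right end of the inversion made by the cross c. *)
pose f (c : nat * nat) := pi (V^-1%g (c.1 + c.2)%N).
rewrite -size_filter -(size_map f) -[l in (_ <= l)%N](size_iota 0 l).
apply: uniq_leq_size.
  rewrite map_inj_in_uniq ?filter_uniq// => -[a b] [a' b'].
  rewrite !mem_filter /= => /andP[/eqP -> _] /andP[/eqP -> _].
  by rewrite /f => /sinf_injective E; move: (sinf_injective E) => /= /addnI ->.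
move=> _ /mapP[c + ->]; rewrite mem_filter mem_iota /= add0n => /andP[/eqP ci cQ].
case/splitPr E : {1 2}Q / cQ => [Q1 Q2].
have : (forall d, d \in Q1 -> reading_order d c) /\ (forall d, d \in Q2 -> reading_order c d).
  move: sQ; rewrite E (sorted_pairwise reading_order_trans) pairwise_cat /=.
  case/and3P => /allrelP H1 _ /andP[/allP H2 _]; split=> d dQ.
    by apply: H1; rewrite // mem_head.
  exact: H2.
case=> H1 H2.
have nQ1 : c \notin Q1.
  by move: uQ; rewrite E cat_uniq /= negb_or => /and3P[_ /andP[]].
pose y := [seq (c.1 + c.2)%N | c <- Q2].
have filtQ2 : [seq d <- Q2 | (i <= d.1)%N] = Q2.
  apply/all_filterP/allP => d /H2 /=; rewrite /reading_order ci; lia.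
have VE : V = (wr [seq d <- Q1 | (i <= d.1)%N] * (simple (c.1 + c.2) * wr Q2))%g.
  by rewrite /V E filter_cat /= ci leqnn filtQ2 /wr map_cat big_cat /= big_cons ci.
have wQ : wr Q = w by [].
have wd : [seq (c.1 + c.2)%N | c <- Q1] ++ (c.1 + c.2)%N :: y = [seq (c.1 + c.2)%N | c <- Q].
  by rewrite E map_cat.
have redQ : size ([seq (c.1 + c.2)%N | c <- Q1] ++ (c.1 + c.2)%N :: y) =
  len (\prod_(k <- [seq (c.1 + c.2)%N | c <- Q1] ++ (c.1 + c.2)%N :: y) simple k)%g.
  by rewrite wd -/(wr Q) wQ -sP size_map size_sort.
have := reduced_word_inversion redQ.
rewrite wd -/(wr Q) wQ -/(wr Q2).
set p := ((wr Q2)^-1 _)%g; set q := ((wr Q2)^-1 _)%g => -[pq wpq].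
have -> : f c = pi q.
  rewrite /f; congr (pi _); apply: (@sinf_injective V); rewrite sinfKV VE !mulsE sinfKV.
  rewrite simpleE (gtn_eqF (ltnSn _)) eqxx; apply/esym/word_fixes.
    apply/allP => a /mapP[d]; rewrite mem_filter => /andP[/= id dQ1] ->.
    have dc : d != c by apply: contraNneq nQ1 => <-.
    by have := H1 _ dQ1; move: dc; rewrite -pair_eqE /pair_eq /reading_order /=; lia.
  apply/allP => a /mapP[d]; rewrite mem_filter => /andP[/= id dQ1] ->.
  have dc : d != c by apply: contraNneq nQ1 => <-.
  by have := H1 _ dQ1; move: dc; rewrite -pair_eqE /pair_eq /reading_order /=; lia.
apply: (Hl p) => //; last exact: wpi.
rewrite leqNgt; apply/negP => pi_.
have : wr Q2 p = p.
  apply: word_fixes; apply/allP => a /mapP[d /H2]; rewrite /reading_order; lia.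
by move=> E0; move: pi_; rewrite -E0 /p sinfKV -ci ltnNge leq_addr.
Qed.

End PipeDreams.

(** * Linear operators on polynomials *)

Lemma malgUZ (R : nzRingType) (K : monomType) (c : R) (k : K) :
  (<< c *g k >> = c *: << k >>)%R.
Proof.
apply/malgP => k'; rewrite mcoeffZ !mcoeffU.
by case: (_ == _); rewrite ?mulr0n ?mulr1n ?mulr0 ?mulr1.
Qed.

Section MonomialExtension.
Local Open Scope ring_scope.
Variables (I : choiceType) (V : lmodType int).
Local Notation PolI := {malg int[{cmonom I}]}.
Implicit Types (p q : PolI) (m : {cmonom I}) (g : {cmonom I} -> V).

(** Linear extension of a map defined on monomials. The padding of polynomials,
    the exchange of two variables and the derivation [witt] are of this form. *)
Definition mext g p : V := \sum_(m <- msupp p) p@_m *: g m.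

Lemma mextEw g p (d : {fset {cmonom I}}) : (msupp p `<=` d)%fset ->
  mext g p = \sum_(m <- d) p@_m *: g m.
Proof.
move=> pd; rewrite /mext (big_fset_incl _ pd) // => m _ /mcoeff_outdom ->.
by rewrite scale0r.
Qed.

Lemma mext_is_linear g : linear (mext g).
Proof.
move=> c p q; pose d := (msupp (c *: p + q) `|` msupp p `|` msupp q)%fset.
rewrite !(@mextEw _ _ d) /d; first last.
- by apply/fsubsetP => m; rewrite !in_fsetU => ->; rewrite ?orbT.
- by apply/fsubsetP => m; rewrite !in_fsetU => ->; rewrite ?orbT.
- by apply/fsubsetP => m; rewrite !in_fsetU => ->; rewrite ?orbT.
rewrite scaler_sumr -big_split; apply: eq_bigr => m _ /=.
by rewrite mcoeffD mcoeffZ scalerDl scalerA.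
Qed.

Lemma mextU g m : mext g << m >> = g m.
Proof. by rewrite /mext msuppU1 big_seq_fset1 mcoeffUU scale1r. Qed.

Lemma eq_mext g g' p : {in msupp p, g =1 g'} -> mext g p = mext g' p.
Proof. by move=> gg; apply: eq_big_seq => m mp; rewrite gg. Qed.

Lemma malg_lin_ext (f f' : PolI -> V) : linear f -> linear f' ->
  (forall m, f << m >> = f' << m >>) -> f =1 f'.
Proof.
move=> Lf Lf' ff' p; rewrite [p]monalgE; elim/big_rec: _ => [|m q _ E].
  by rewrite -(addNr << mone >>) -scaleN1r Lf Lf' ff'.
by rewrite malgUZ Lf Lf' ff' E.
Qed.

End MonomialExtension.

Section LinearMaps.
Local Open Scope ring_scope.

Lemma eq_add (U : nmodType) (a b a' b' : U) : a = a' -> b = b' -> a + b = a' + b'.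
Proof. by move=> -> ->. Qed.

Lemma mulrn_delta (U : nmodType) (P : nat -> U) k i : P i *+ (k == i) = P k *+ (k == i).
Proof. by case: eqP => [->|]. Qed.

Lemma lin_comp (U W Z : lmodType int) (f : W -> Z) (g : U -> W) :
  linear f -> linear g -> linear (fun p => f (g p)).
Proof. by move=> Lf Lg c p q; rewrite Lg Lf. Qed.

Lemma lin_add (U W : lmodType int) (f g : U -> W) :
  linear f -> linear g -> linear (fun p => f p + g p).
Proof. by move=> Lf Lg c p q; rewrite Lf Lg scalerDr addrACA. Qed.

Lemma lin_mul (A : comAlgType int) (x : A) : linear (fun p => x * p).
Proof. by move=> c p q; rewrite mulrDr scalerAr. Qed.

Lemma lin_mcoeff (K : choiceType) (k : K) :
  linear (fun p : {malg int[K]} => p@_k : int^o).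
Proof. by move=> c p q; rewrite mcoeffD mcoeffZ. Qed.

Lemma lin0 (U W : lmodType int) (f : U -> W) : linear f -> f 0 = 0.
Proof. by move=> Lf; rewrite -(addNr 0) -scaleN1r Lf scaleN1r addNr. Qed.

Lemma lin_sum (I : Type) (r : seq I) (P : pred I) (U W : lmodType int) (f : U -> W)
    (F : I -> U) :
  linear f -> f (\sum_(i <- r | P i) F i) = \sum_(i <- r | P i) f (F i).
Proof.
move=> Lf; elim: r => [|i r IH]; first by rewrite !big_nil lin0.
by rewrite !big_cons; case: ifP => // _; rewrite -{1}[F i]scale1r Lf scale1r IH.
Qed.

Lemma lin_scale (U W : lmodType int) (f : U -> W) c p : linear f -> f (c *: p) = c *: f p.
Proof.
by move=> Lf; rewrite -[c *: p]addr0 Lf lin0 ?addr0.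
Qed.

Lemma lin_muln (U W : lmodType int) (f : U -> W) n p : linear f -> f (p *+ n) = f p *+ n.
Proof. by move=> Lf; rewrite -!scaler_nat lin_scale. Qed.

Lemma sum_scale_swap (A : comAlgType int) (x : nat -> A) (c : nat -> int) K k q :
  (k < K)%N -> (k.+1 < K)%N ->
  \sum_(i < K) c i *: (x (simple k i) * q) =
  (\sum_(i < K) c i *: x i - (c k - c k.+1) *: (x k - x k.+1)) * q.
Proof.
move=> k1 k2; rewrite mulrBl mulr_suml.
rewrite (bigD1 (Ordinal k1)) //= [X in _ + X](bigD1 (Ordinal k2)) /=; last first.
  by rewrite -val_eqE /= gtn_eqF.
rewrite [X in _ = X - _](bigD1 (Ordinal k1)) //= [X in _ = _ + X - _](bigD1 (Ordinal k2)) /=; last first.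
  by rewrite -val_eqE /= gtn_eqF.
have -> : \sum_(i < K | (i != Ordinal k1) && (i != Ordinal k2)) c i *: (x (simple k i) * q) =
   \sum_(i < K | (i != Ordinal k1) && (i != Ordinal k2)) c i *: x i * q.
  apply: eq_bigr => i; rewrite -!val_eqE /= => /andP[ik ik1].
  by rewrite simpleE (negPf ik) (negPf ik1) scalerAl.
rewrite !simpleE !eqxx (gtn_eqF (ltnSn k)) -!scalerAl mulrBl.
move: (\sum_(i < K | _) _) (x k * q) (x k.+1 * q) => T u v.
rewrite !(scalerBl, scalerBr) !opprD !opprK !addrA.
ring.
Qed.

End LinearMaps.

Section SwapAndDerivation.
Local Open Scope ring_scope.
Implicit Types (p q : Pol) (m : {cmonom nat}) (i j k : nat).

Lemma cmonomP (I : choiceType) (m m' : {cmonom I}) : m =1 m' -> m = m'.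
Proof. by move=> mm; apply/eqP/cmP. Qed.

Definition mswap k m : {cmonom nat} :=
  [cmonom m (simple k i) | i in (simple k @` finsupp m)%fset]%M.

Lemma mem_simple_imfset k (A : {fset nat}) i :
  (i \in (simple k @` A)%fset) = (simple k i \in A).
Proof.
apply/imfsetP/idP => [[j jA ->]|iA]; first by rewrite simple_invK.
by exists (simple k i) => //; exact/esym/simple_invK.
Qed.

Lemma mswapE k m i : mswap k m i = m (simple k i).
Proof.
rewrite /mswap cmE fsfun_fun mem_simple_imfset; case: ifPn => // ni.
by apply/esym/eqP; rewrite cmE_eq0.
Qed.

Lemma mswapK k : involutive (mswap k).
Proof. by move=> m; apply: cmonomP => i; rewrite !mswapE simple_invK. Qed.

Lemma mswapM k m m' : mswap k (mmul m m') = mmul (mswap k m) (mswap k m').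
Proof. by apply: cmonomP => i; rewrite !(mswapE, cmM). Qed.

Lemma mswapU k i : mswap k (ucm i) = ucm (simple k i).
Proof.
apply: cmonomP => j; rewrite mswapE !ucmE; congr nat_of_bool.
by apply/eqP/eqP => [->|<-]; rewrite simple_invK.
Qed.

Lemma finsupp_mswap k m : finsupp (mswap k m) = (simple k @` finsupp m)%fset.
Proof.
by apply/fsetP => i; rewrite mem_simple_imfset -!cmE_neq0 mswapE.
Qed.

(** The exchange of the variables x_k and x_(k+1). *)
Definition sigma k : Pol -> Pol := mext (fun m => << mswap k m >>).

Lemma sigmaU k m : sigma k << m >> = << mswap k m >>.
Proof. exact: mextU. Qed.

Lemma lin_sigma k : linear (sigma k).
Proof. exact: mext_is_linear. Qed.

Lemma sigmaX k i p : sigma k (Xv i * p) = Xv (simple k i) * sigma k p.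
Proof.
apply: (malg_lin_ext (f := fun p => sigma k (Xv i * p))
                     (f' := fun p => Xv (simple k i) * sigma k p)).
- exact: lin_comp (lin_sigma k) (lin_mul _).
- exact: lin_comp (lin_mul _) (lin_sigma k).
move=> m; etransitivity; first exact: congr1 (malgUM _ _).
etransitivity; first exact: sigmaU.
apply: esym; etransitivity; first exact: congr1 (sigmaU k m).
etransitivity; first exact: malgUM.
by congr << _ >>; rewrite mswapM mswapU.
Qed.

Lemma sigma1 k : sigma k 1 = 1.
Proof.
etransitivity; first exact: sigmaU.
by congr << _ >>; apply: cmonomP => i; rewrite mswapE !cm1.
Qed.

Lemma mcoeff_sigma k p m : (sigma k p)@_m = p@_(mswap k m).
Proof.
apply: (malg_lin_ext (V := int^o) (f := fun p => (sigma k p)@_m)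
                     (f' := fun p => p@_(mswap k m))).
- exact: lin_comp (lin_mcoeff _) (lin_sigma k).
- exact: lin_mcoeff.
move=> m'; rewrite sigmaU [LHS]mcoeffU1 [RHS]mcoeffU1; congr (nat_of_bool _)%:R.
by apply/eqP/eqP => [<-|->]; rewrite mswapK.
Qed.

(** If x_B is the variable of largest index in p, then sigma_B p contains the
    variable x_(B+1). *)
Lemma sigma_invariant_eq0 p : (forall k, sigma k p = p) -> p@_mone = 0 -> p = 0.
Proof.
move=> inv p1; pose bd B := forall m, m \in msupp p -> forall i, (B <= i)%N -> m i = 0%N.
have [B0 HB0] : exists B, bd B.
  exists (\max_(m <- msupp p) \max_(i <- finsupp m) i.+1)%N => m mp i.
  apply: contraTeq; rewrite -ltnNge cmE_neq0 => im.
  apply: (leq_trans _ (@leq_bigmax_seq _ _ xpredT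
    (fun m : {cmonom nat} => \max_(i <- finsupp m) i.+1)%N m mp isT)).
  exact: (@leq_bigmax_seq _ _ xpredT succn i im isT).
have exB : exists B, `[< bd B >] by exists B0; apply/asboolP.
case: (ex_minnP exB) => -[|B] /asboolP HB minB.
  apply/malgP => m; rewrite mcoeff0; case: (boolP (m \in msupp p)) => [mp|/mcoeff_outdom//].
  suff -> : m = mone by [].
  by apply: cmonomP => i; rewrite cm1 (HB m mp).
have : ~ bd B by move=> bB; have := minB B (asboolT bB); rewrite ltnn.
case=> m mp i; rewrite leq_eqVlt => /predU1P[<-{i}|]; last exact: HB.
(* Here B is the largest index of a variable in p, and B.+1 the least bound. *)
have -> : m B = mswap B m B.+1 by rewrite mswapE simpleE eqxx (gtn_eqF (ltnSn B)).
apply: HB => //; rewrite -mcoeff_neq0 -(inv B) mcoeff_sigma mswapK.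
by rewrite mcoeff_neq0.
Qed.

Definition witt_monom m : Pol := \sum_(i <- finsupp m) << mmul (ucm i) m >> *+ m i.
(** The derivation sum_i x_i^2 d/dx_i, one of the generators of the Witt
    algebra. *)
Definition witt : Pol -> Pol := mext witt_monom.

Lemma wittU m : witt << m >> = witt_monom m.
Proof. exact: mextU. Qed.

Lemma lin_witt : linear witt.
Proof. exact: mext_is_linear. Qed.

Lemma witt_monomEw m (d : {fset nat}) : (finsupp m `<=` d)%fset ->
  witt_monom m = \sum_(i <- d) << mmul (ucm i) m >> *+ m i.
Proof.
move=> md; rewrite /witt_monom (big_fset_incl _ md) // => i _.
by rewrite -cmE_eq0 => /eqP ->.
Qed.

Lemma wittX k p : witt (Xv k * p) = Xv k * (Xv k * p) + Xv k * witt p.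
Proof.
apply: (malg_lin_ext (f := fun p => witt (Xv k * p))
                     (f' := fun p => Xv k * (Xv k * p) + Xv k * witt p)).
- exact: lin_comp lin_witt (lin_mul _).
- apply: lin_add; first exact: lin_comp (lin_mul _) (lin_mul _).
  exact: lin_comp (lin_mul _) lin_witt.
move=> m.
pose d := (k |` finsupp m)%fset; pose km := mmul (ucm k) m.
have E1 : Xv k * << m >> = << km >> by exact: malgUM.
have E2 : Xv k * << km >> = << mmul (ucm k) km >> by exact: malgUM.
have H1 : witt (Xv k * << m >>) = witt_monom km := etrans (congr1 witt E1) (wittU km).
have H2 : Xv k * (Xv k * << m >>) = << mmul (ucm k) km >> := etrans (congr1 _ E1) E2.
apply: (etrans H1); apply: esym.
apply: (etrans (eq_add H2 (congr1 ( *%R (Xv k)) (wittU m)))); apply: esym.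
rewrite (@witt_monomEw km d); last first.
  apply/fsubsetP => i; rewrite -cmE_neq0 cmM ucmE in_fsetU in_fset1 -cmE_neq0.
  by rewrite addn_eq0 negb_and eqb0 negbK eq_sym.
rewrite (@witt_monomEw m d) ?fsubsetU1//.
etransitivity.
  apply: (eq_bigr (fun i => << mmul (ucm k) km >> *+ (k == i) +
    << mmul (ucm k) (mmul (ucm i) m) >> *+ m i)) => i _.
  have -> : km i = ((k == i) + m i)%N.
    exact: etrans (cmM _ _ _) (congr1 (addn^~ _) (ucmE _ _)).
  have A := mulrn_delta (fun i => << mmul (ucm i) km >> : Pol) k i.
  have B : mmul (ucm i) km = mmul (ucm k) (mmul (ucm i) m).
    by rewrite /km !mulmA (mulmC (ucm i)).
  have B' : << mmul (ucm i) km >> *+ m i = << mmul (ucm k) (mmul (ucm i) m) >> *+ m i :> Pol.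
    exact: (congr1 (fun a : {cmonom nat} => (<< a >> : Pol) *+ m i) B).
  have C := mulrnDr (<< mmul (ucm i) km >> : Pol) (k == i) (m i).
  apply: (etrans C); exact: eq_add A B'.
apply: (etrans (big_split _ _ _ _ _)) => /=; congr (_ + _).
  rewrite (big_fsetD1 k) /=; last by rewrite in_fsetU in_fset1 eqxx.
  rewrite eqxx big1_fset; first exact: addr0.
  move=> i; rewrite in_fsetD1 => /andP[ik _] _.
  by rewrite eq_sym (negPf ik).
apply: esym; apply: (etrans (mulr_sumr _ _ _ _)); apply: eq_bigr => i _.
apply: (etrans (mulrnAr _ _ _)); congr (_ *+ _); exact: malgUM.
Qed.

Lemma sigma_witt k p : sigma k (witt p) = witt (sigma k p).
Proof.
apply: (malg_lin_ext (f := fun p => sigma k (witt p)) (f' := fun p => witt (sigma k p))).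
- exact: lin_comp (lin_sigma k) lin_witt.
- exact: lin_comp lin_witt (lin_sigma k).
move=> m; rewrite wittU sigmaU wittU /witt_monom finsupp_mswap.
rewrite big_imfset /=; last by move=> i j _ _; exact: (can_inj (simple_invK k)).
rewrite (lin_sum _ _ _ (lin_sigma k)); apply: eq_bigr => i _.
rewrite (lin_muln _ _ (lin_sigma k)) mswapE simple_invK; congr (_ *+ _).
etransitivity; first exact: sigmaU.
by congr << _ >>; rewrite mswapM mswapU.
Qed.

Lemma mcoeff1_mulX i p : (Xv i * p)@_mone = 0.
Proof.
apply: (malg_lin_ext (V := int^o) (f := fun p => (Xv i * p)@_mone) (f' := fun=> 0)).
- exact: lin_comp (lin_mcoeff _) (lin_mul _).
- by move=> c q r; rewrite scaler0 addr0.
move=> m; etransitivity; first exact: congr1 (malgUM _ _).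
by rewrite mcoeffU1 cmM_eq1 cm1_eq1.
Qed.

Lemma mcoeff1_witt p : (witt p)@_mone = 0.
Proof.
apply: (malg_lin_ext (V := int^o) (f := fun p => (witt p)@_mone) (f' := fun=> 0)).
- exact: lin_comp (lin_mcoeff _) lin_witt.
- by move=> c q r; rewrite scaler0 addr0.
move=> m; rewrite wittU /witt_monom raddf_sum big1 //= => i _.
by rewrite mcoeffMn mcoeffU1 cmM_eq1 cm1_eq1 mul0rn.
Qed.

Definition lform K (c : nat -> int) : Pol := \sum_(i < K) c i *: Xv i.

Lemma lform_widen M K c : (M <= K)%N -> (forall i, (M <= i)%N -> c i = 0) ->
  lform M c = lform K c.
Proof.
move=> MK cM; rewrite /lform (big_ord_widen K (fun i => c i *: Xv i)) //.
rewrite [RHS](bigID (fun i : 'I_K => (i < M)%N)) /= [X in _ = _ + X]big1 ?addr0//.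
by move=> i; rewrite -leqNgt => /cM ->; rewrite scale0r.
Qed.

Lemma mcoeff1_lform K c p : (lform K c * p)@_mone = 0.
Proof.
rewrite mulr_suml raddf_sum big1 //= => i _.
by rewrite -scalerAl mcoeffZ mcoeff1_mulX mulr0.
Qed.

Lemma sigma_lform K c k p : (forall i, (K <= i)%N -> c i = 0) ->
  sigma k (lform K c * p) =
  (lform K c - (c k - c k.+1) *: (Xv k - Xv k.+1)) * sigma k p.
Proof.
move=> cK; have E := @lform_widen K (K + k.+2)%N c (leq_addr _ _) cK; rewrite {}E.
have k1 : (k < K + k.+2)%N by lia.
have k2 : (k.+1 < K + k.+2)%N by lia.
move: (K + k.+2)%N k1 k2 => K' k1 k2.
apply: (etrans (congr1 (sigma k) (mulr_suml _ _ _ _))).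
apply: (etrans (lin_sum _ _ _ (lin_sigma k))).
apply: (etrans _ (sum_scale_swap (fun i => Xv i) c (sigma k p) k1 k2)).
apply: eq_bigr => i _.
apply: (etrans (congr1 (sigma k) (esym (scalerAl (c i) (Xv i) p)))).
apply: (etrans (lin_scale _ _ (lin_sigma k))).
exact: (congr1 (fun y : Pol => c i *: y) (sigmaX k i p)).
Qed.

Lemma sigma_sch N k w :
  sigma k (sch N (fun i => Xv i) w) = sch N (fun i => Xv (simple k i)) w.
Proof.
apply: (etrans (congr1 (sigma k) (sch_sum _ _ _))).
apply: (etrans (lin_sum _ _ _ (lin_sigma k))).
apply: (etrans _ (esym (sch_sum _ _ _))); apply: eq_bigr => Q _.
elim: Q => [|c Q IH]; first by rewrite [in LHS]big_nil [RHS]big_nil; exact: sigma1.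
rewrite [in LHS]big_cons [RHS]big_cons; apply: (etrans (sigmaX _ _ _)).
exact: (congr1 (fun y : Pol => Xv (simple k c.1) * y) IH).
Qed.

(** The divided difference recursion. The staircase is taken large enough for w
    and w s_k and for the rows k and k + 1. *)
Lemma sigma_schubert k w : sigma k (schubert w) =
  schubert w - (Xv k - Xv k.+1) *
    (if descent w k then schubert (w * simple k)%g else 0).
Proof.
have [N0 wN0] := sinf_bound w; pose N := (N0 + k.+2)%N.
have wN i : (N <= i)%N -> w i = i by move=> Ni; apply: wN0; apply: leq_trans Ni; exact: leq_addr.
have wsN i : (N <= i)%N -> (w * simple k)%g i = i.
  move=> Ni; rewrite mulsE simpleE !gtn_eqF ?wN//; apply: leq_trans Ni; rewrite /N; lia.
have kN : (k.+1 < N)%N by rewrite /N; lia.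
have E1 := schubert_sch wN; have E2 := schubert_sch wsN.
etransitivity; first exact: congr1 E1.
etransitivity; first exact: sigma_sch.
etransitivity; first exact: (sch_swap (fun i => Xv i) w kN).
congr (_ - _ * _); first exact: esym E1.
by case: ifP => _; first exact: esym E2.
Qed.

End SwapAndDerivation.

(** * Covers and the exchange of adjacent positions *)

Section CoverCombinatorics.
Local Open Scope ring_scope.
Implicit Types (w : sinf) (i j k M : nat) (c : nat -> int).

Lemma sinf_lt_fix w M i : (forall i, (M <= i)%N -> w i = i) -> (w i < M)%N = (i < M)%N.
Proof.
move=> wM; case: (leqP M i) => [Mi|iM]; first by rewrite wM // ltnNge Mi.
rewrite ltnNge; apply/negP => Mw.
by have /sinf_injective E := wM _ Mw; rewrite E leqNgt iM in Mw.
Qed.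

Lemma descent_lt w M k : (forall i, (M <= i)%N -> w i = i) -> descent w k -> (k.+1 < M)%N.
Proof.
move=> wM; rewrite /descent => d; case: ltnP => // Mk; move: d.
rewrite (wM _ Mk) => d; have /sinf_injective E := wM (w k) (leq_trans Mk (ltnW d)).
by rewrite E ltnNge leqnSn in d.
Qed.

(** The contribution of p to the number d(w;i,j) of the introduction. If w t_ij
    covers w, exactly one of the two comparisons holds. *)
Definition between_sign w i j p : int :=
  if (i < p < j)%N then (w p < w i)%N%:R - (w j < w p)%N%:R else 0.

Definition cover_coef M c w i j : int :=
  c i - c j + \sum_(p < M.+1) between_sign w i j p.

(** The sequence c s_k + e_k + e_(k+1): the error that sigma_k makes in the
    identity for w and c is the identity for w s_k and this sequence. *)
Definition swap_coef k c : nat -> int :=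
  fun i => c (simple k i) + ((i == k) || (i == k.+1))%:R.

Lemma simple_l k : simple k k = k.+1.
Proof. by rewrite simpleE eqxx. Qed.

Lemma simple_r k : simple k k.+1 = k.
Proof. by rewrite simpleE eqxx gtn_eqF. Qed.

Lemma simple_lt k i j : (i, j) != (k, k.+1) -> (i, j) != (k.+1, k) ->
  (simple k i < simple k j)%N = (i < j)%N.
Proof.
rewrite !xpair_eqE !simpleE => H1 H2.
by move: H1 H2; repeat case: eqP => //=; lia.
Qed.

Lemma transp_simple k i j :
  (transp (simple k i) (simple k j) * simple k = simple k * transp i j)%g.
Proof. exact: transp_mul. Qed.

Lemma simple_transp k i j :
  (simple k * transp (simple k i) (simple k j) = transp i j * simple k)%g.
Proof. by rewrite -transp_mul !simple_invK. Qed.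

Lemma cover_coef_adj M c w k : cover_coef M c w k k.+1 = c k - c k.+1.
Proof.
rewrite /cover_coef big1 ?addr0 // => p _; rewrite /between_sign.
by case: ifP => //; lia.
Qed.

(** Conjugation by s_k matches the covers u of w that have a descent at k with
    the covers u s_k of w s_k: one has w s_k t_ij s_k = w t_(s_k i, s_k j), and
    passing to u s_k and w s_k lowers both lengths by one. *)
Lemma cover_swap w k i j : descent w k -> (i, j) != (k, k.+1) -> (i, j) != (k.+1, k) ->
  is_cover w (simple k i) (simple k j) &&
    descent (w * transp (simple k i) (simple k j))%g k =
  is_cover (w * simple k)%g i j.
Proof.
move=> wk n1 n2; rewrite /is_cover simple_lt //; case: (ltnP i j) => //= ij.
have sij : (simple k i < simple k j)%N by rewrite simple_lt.
have lw := len_descent wk; rewrite descentP.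
have -> : (w * transp (simple k i) (simple k j) * simple k =
           w * simple k * transp i j)%g by rewrite -!mulgA transp_simple.
have lu := len_mulsr k (w * simple k * transp i j)%g.
have uE : (w * simple k * transp i j * simple k = w * transp (simple k i) (simple k j))%g.
  have -> : (w * simple k * transp i j =
             w * transp (simple k i) (simple k j) * simple k)%g.
    by rewrite -!mulgA transp_simple.
  by rewrite -mulgA simpleK mulg1.
rewrite {}uE in lu.
apply/andP/eqP => [[/eqP l1 /eqP l2]|l1].
  by apply: succn_inj; rewrite -l2 l1 lw.
have cv : is_cover (w * simple k)%g i j by rewrite /is_cover ij l1 eqxx.
have [_] := cover_lt cv; rewrite !mulsE => wij.
have := len_transp_gt sij wij; rewrite l1 -lw => l2.
move: lu; rewrite l1 -lw => lu.
have -> : len (w * transp (simple k i) (simple k j))%g = (len w).+1.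
  by apply/anti_leq; rewrite lu l2.
by rewrite eqxx.
Qed.

(** Conjugation by s_k keeps the order of p, i and j, unless k and k + 1 are the
    points p and i, or p and j. Then p is between i and j on one side only, and
    the sign that it contributes is forced by the descent of w and by the cover
    condition. *)
Lemma between_sign_swap w k i j p : descent w k ->
    is_cover (w * simple k)%g i j -> (i, j) != (k, k.+1) ->
  between_sign w (simple k i) (simple k j) (simple k p) =
  between_sign (w * simple k)%g i j p +
    ((p == simple k i) && ((i == k) || (i == k.+1)))%:R -
    ((p == simple k j) && ((j == k) || (j == k.+1)))%:R.
Proof.
move=> wk cv nij; have [ij vij] := cover_lt cv.
have btw := @cover_between _ i j p cv.
have vk : ((w * simple k)%g k < (w * simple k)%g k.+1)%N.
  by rewrite !mulsE simple_l simple_r.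
rewrite /between_sign.
have E x : w (simple k x) = (w * simple k)%g x by rewrite mulsE.
rewrite !E; set v := (w * simple k)%g in cv vij btw vk *.
have sk x y : (x == simple k y) = (simple k x == y).
  by rewrite -(sinf_eq (simple k)) simple_invK.
rewrite !sk; clear E sk.
move: nij; rewrite xpair_eqE negb_and => nij.
have pE x : simple k p = x -> p = simple k x by move=> <-; rewrite simple_invK.
have sid x : x != k -> x != k.+1 -> simple k x = x.
  by move=> xk xk1; rewrite simpleE (negPf xk) (negPf xk1).
case: (boolP ((simple k p == i) && ((i == k) || (i == k.+1)))) => [|nA].
  case/andP => /eqP spi /orP[]/eqP ik; move: (pE _ spi); rewrite ik ?simple_l ?simple_r => pk.
    have kj : (k.+1 < j)%N by lia.
    have vj : (v j < v k.+1)%N by move: btw; rewrite pk ik; lia.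
    have sj : simple k j = j by apply: sid; lia.
    rewrite pk ?simple_l ?simple_r sj ltnSn kj vj.
    have -> : (v k.+1 < v k)%N = false by lia.
    have -> : (k.+1 < k)%N = false by lia.
    by have -> : (k == j) = false by lia.
  have kj : (k.+1 < j)%N by lia.
  have sj : simple k j = j by apply: sid; lia.
  rewrite pk ?simple_l ?simple_r sj ltnSn kj vk.
  have -> : (v j < v k)%N = false by rewrite ik in vij; lia.
  have -> : (k.+1 < k)%N = false by lia.
  by have -> : (k.+1 == j) = false by lia.
case: (boolP ((simple k p == j) && ((j == k) || (j == k.+1)))) => [|nB].
  case/andP => /eqP spj /orP[]/eqP jk; move: (pE _ spj); rewrite jk ?simple_l ?simple_r => pk.
    have ki : (i < k)%N by lia.
    have si : simple k i = i by apply: sid; lia.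
    rewrite pk ?simple_l ?simple_r si ltnSn ki vk.
    have -> : (v k.+1 < v i)%N = false by rewrite jk in vij; lia.
    have -> : (k.+1 < k)%N = false by lia.
    by rewrite andbF.
  have ki : (i < k)%N by lia.
  have vi : (v k < v i)%N by move: btw; rewrite pk jk; lia.
  have si : simple k i = i by apply: sid; lia.
  rewrite pk ?simple_l ?simple_r si ltnSn ki vi.
  have -> : (v k.+1 < v k)%N = false by lia.
  have -> : (k.+1 < k)%N = false by lia.
  by rewrite andbF.
rewrite addr0 subr0; have nik : (i, p) != (k, k.+1) /\ (i, p) != (k.+1, k).
  rewrite !xpair_eqE; split; apply/negP => /andP[/eqP ik /eqP pk];
  by move: nA; rewrite ik pk ?simple_l ?simple_r eqxx ?orbT.
have njk : (p, j) != (k, k.+1) /\ (p, j) != (k.+1, k).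
  rewrite !xpair_eqE; split; apply/negP => /andP[/eqP pk /eqP jk];
  by move: nB; rewrite jk pk ?simple_l ?simple_r eqxx ?orbT.
by rewrite !simple_lt; case: nik njk => ? ? [].
Qed.

(** The corrections in [between_sign_swap] are the unit vectors added in
    [swap_coef]. *)
Lemma cover_coef_swap M w k c i j : descent w k -> (k.+1 < M)%N ->
    (i <= M)%N -> (j <= M)%N ->
    is_cover (w * simple k)%g i j -> (i, j) != (k, k.+1) ->
  cover_coef M c w (simple k i) (simple k j) =
  cover_coef M (swap_coef k c) (w * simple k)%g i j.
Proof.
move=> wk kM iM jM cv nij; rewrite /cover_coef.
have sM (x : 'I_M.+1) : (simple k x < M.+1)%N by rewrite simpleE; have := ltn_ord x; repeat case: eqP; lia.
pose h (x : 'I_M.+1) : 'I_M.+1 := Ordinal (sM x).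
have hK : involutive h by move=> x; apply: val_inj; rewrite /= simple_invK.
rewrite (reindex_inj (inv_inj hK)) /=.
under eq_bigr => p _ do rewrite (between_sign_swap p wk cv nij).
rewrite sumrB big_split /=.
have ind x b : (x <= M)%N -> \sum_(p < M.+1) ((p == simple k x :> nat) && b)%:R = b%:R :> int.
  move=> xM; have sx : (simple k x < M.+1)%N := sM (Ordinal (xM : x < M.+1)%N).
  rewrite (bigD1 (Ordinal sx)) //= eqxx big1 ?addr0 // => p.
  by rewrite -val_eqE /= => /negPf ->.
by rewrite !ind // /swap_coef; ring.
Qed.

Variable V : lmodType int.
Variable S : sinf -> V.

(** This holds for every function S, since it only concerns the covers. If k is
    an ascent of w, then w s_k is the only cover of w with a descent at k, and it
    gives the first summand. If k is a descent, the covers of w s_k correspond to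
    those of w with a descent at k, except that w is itself a cover of w s_k; the
    first summand cancels its contribution. *)
Lemma cover_sum_swap M w k c : (forall i, (M <= i)%N -> w i = i) ->
    (forall i, (M <= i)%N -> c i = 0) ->
  \sum_(ij : 'I_M.+1 * 'I_M.+1 | is_cover w ij.1 ij.2) cover_coef M c w ij.1 ij.2 *:
    (if descent (w * transp ij.1 ij.2)%g k then S (w * transp ij.1 ij.2 * simple k)%g else 0) =
  (c k - c k.+1) *: S w +
  if descent w k then
    \sum_(ij : 'I_M.+1 * 'I_M.+1 | is_cover (w * simple k)%g ij.1 ij.2)
       cover_coef M (swap_coef k c) (w * simple k)%g ij.1 ij.2 *:
       S (w * simple k * transp ij.1 ij.2)%g
  else 0.
Proof.
move=> wM cM; case: (boolP (descent w k)) => wk; last first.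
  rewrite addr0; have only (i j : nat) : is_cover w i j -> descent (w * transp i j)%g k ->
      (i, j) = (k, k.+1).
    move=> cv; have [ij wij] := cover_lt cv; move/len_descent => lu.
    apply/eqP/negPn/negP => n1.
    have n2 : (i, j) != (k.+1, k).
      apply/negP => /eqP[ik jk]; move: ij; rewrite ik jk; lia.
    have sij : (simple k i < simple k j)%N by rewrite simple_lt.
    have := @len_transp_gt (w * simple k)%g _ _ sij.
    rewrite !mulsE !simple_invK => /(_ wij).
    rewrite -mulgA simple_transp mulgA (len_ascent wk).
    by move: cv lu; rewrite /is_cover ij /= => /eqP -> [<-]; rewrite ltnNge leqnSn.
  case: (ltnP k M) => [kM|Mk]; last first.
    rewrite (cM k) // (cM k.+1); last exact: leqW.
    rewrite subrr scale0r big1 // => -[i j] /= cv; case: ifP => [dk|]; last by rewrite scaler0.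
    by have [_ jk] := only _ _ cv dk; have := ltn_ord j; rewrite jk ltnS ltnNge Mk.
  have k0 : (k < M.+1)%N by exact: ltnW.
  have k1 : (k.+1 < M.+1)%N by [].
  have cvk : is_cover w k k.+1 by rewrite /is_cover ltnSn -/(simple k) len_ascent ?eqxx.
  rewrite (bigD1 (Ordinal k0, Ordinal k1)) //= big1 ?addr0 => [|[i j] /= /andP[cv nij]].
    rewrite -/(simple k) -mulgA simpleK mulg1 cover_coef_adj ifT //.
    by rewrite descentP -mulgA simpleK mulg1 len_ascent ?eqxx.
  case: ifP => [dk|]; last by rewrite scaler0.
  have [ik jk] := only _ _ cv dk; case/negP: nij; apply/eqP.
  by congr pair; apply: val_inj.
have kM := descent_lt wM wk; have lw := len_descent wk.
pose T (i j : nat) := if is_cover w i j && descent (w * transp i j)%g k then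
  cover_coef M c w i j *: S (w * transp i j * simple k)%g else 0.
pose U (i j : nat) := if is_cover (w * simple k)%g i j then
  cover_coef M (swap_coef k c) (w * simple k)%g i j *:
       S (w * simple k * transp i j)%g else 0.
have -> : \sum_(ij : 'I_M.+1 * 'I_M.+1 | is_cover w ij.1 ij.2) cover_coef M c w ij.1 ij.2 *:
    (if descent (w * transp ij.1 ij.2)%g k then S (w * transp ij.1 ij.2 * simple k)%g else 0) =
    \sum_(ij : 'I_M.+1 * 'I_M.+1) T ij.1 ij.2.
  rewrite big_mkcond; apply: eq_bigr => ij _; rewrite /T.
  by case: (is_cover _ _ _) => //=; case: ifP => // _; rewrite scaler0.
have -> : \sum_(ij : 'I_M.+1 * 'I_M.+1 | is_cover (w * simple k)%g ij.1 ij.2)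
       cover_coef M (swap_coef k c) (w * simple k)%g ij.1 ij.2 *:
       S (w * simple k * transp ij.1 ij.2)%g = \sum_(ij : 'I_M.+1 * 'I_M.+1) U ij.1 ij.2.
  by rewrite big_mkcond.
have sM (x : 'I_M.+1) : (simple k x < M.+1)%N by rewrite simpleE; have := ltn_ord x; repeat case: eqP; lia.
pose h (x : 'I_M.+1) : 'I_M.+1 := Ordinal (sM x).
have hK : involutive h by move=> x; apply: val_inj; rewrite /= simple_invK.
pose h2 (x : 'I_M.+1 * 'I_M.+1) := (h x.1, h x.2).
have h2K : involutive h2 by move=> [x y]; rewrite /h2 /= !hK.
rewrite (reindex_inj (inv_inj h2K)) /=.
have k0 : (k < M.+1)%N by lia.
have k1 : (k.+1 < M.+1)%N by lia.
have TU (i j : nat) : (i <= M)%N -> (j <= M)%N -> T (simple k i) (simple k j) =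
    U i j + if (i, j) == (k, k.+1) then (c k - c k.+1) *: S w else 0.
  move=> iM jM; rewrite /T /U; case: (altP ((i, j) =P (k, k.+1))) => [[-> ->]|n1].
    rewrite simple_l simple_r.
    have -> : is_cover w k.+1 k = false by rewrite /is_cover ltnNge leqnSn.
    have -> : is_cover (w * simple k)%g k k.+1.
      by rewrite /is_cover ltnSn -/(simple k) -mulgA simpleK mulg1 lw eqxx.
    rewrite /= -/(simple k) -mulgA simpleK mulg1.
    rewrite cover_coef_adj /swap_coef simple_l simple_r !eqxx orbT -scalerDl.
    by rewrite [X in X *: _](_ : _ = 0) ?scale0r //=; ring.
  rewrite addr0; case: (altP ((i, j) =P (k.+1, k))) => [[-> ->]|n2].
    rewrite simple_l simple_r.
    have -> : is_cover (w * simple k)%g k.+1 k = false by rewrite /is_cover ltnNge leqnSn.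
    suff -> : is_cover w k k.+1 = false by [].
    by apply/negP => /cover_lt[_]; move: wk; rewrite /descent; lia.
  rewrite cover_swap //; case: ifP => // cv.
  rewrite cover_coef_swap //; congr (_ *: S _).
  by rewrite -!mulgA transp_simple.
under eq_bigr => x _ do rewrite TU -1?ltnS ?ltn_ord //.
rewrite big_split /= addrC; congr (_ + _).
rewrite (bigD1 (Ordinal k0, Ordinal k1)) //= eqxx big1 ?addr0 // => -[i j] nij.
case: eqP => // -[ik jk]; case/negP: nij; apply/eqP.
by congr pair; apply: val_inj.
Qed.

End CoverCombinatorics.

(** * First-order operators on Schubert polynomials *)

Section KeyIdentity.
Local Open Scope ring_scope.

(** The induction step of [schubert_raising], where x and y are the exchanged
    variables, S and D the polynomials of w and of w s_k (or 0), W and WD their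
    images under the derivation, and R and E the right-hand sides for w and for
    w s_k. *)
Lemma divided_difference_step (A : comAlgType int) (x y L S D W WD R E sLS sW sR : A) (a : int) :
  sLS = (L - a *: (x - y)) * (S - (x - y) * D) ->
  sW = W - ((x * x - y * y) * D + (x - y) * WD) ->
  sR = R - (x - y) * (a *: S + E) ->
  (L - a *: (x - y) + (x + y)) * D + WD = E ->
  sLS + sW - sR = L * S + W - R.
Proof.
have [b aE] : exists b : A, forall z, a *: z = b * z.
  by exists a%:A => z; rewrite mulr_algl.
by move=> -> -> -> <-; rewrite !aE; ring.
Qed.

Lemma swap_coef_sum (A : comAlgType int) (x : nat -> A) (c : nat -> int) K k :
  (k.+1 < K)%N ->
  \sum_(i < K) swap_coef k c i *: x i =
  \sum_(i < K) c i *: x i - (c k - c k.+1) *: (x k - x k.+1) + (x k + x k.+1).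
Proof.
move=> k1; have k0 : (k < K)%N by exact: ltnW.
rewrite (bigD1 (Ordinal k0)) //= [X in _ + X](bigD1 (Ordinal k1)) /=; last first.
  by rewrite -val_eqE /= gtn_eqF.
rewrite [X in _ = X - _ + _](bigD1 (Ordinal k0)) //= [X in _ = _ + X - _ + _](bigD1 (Ordinal k1)) /=; last first.
  by rewrite -val_eqE /= gtn_eqF.
have -> : \sum_(i < K | (i != Ordinal k0) && (i != Ordinal k1)) swap_coef k c i *: x i =
   \sum_(i < K | (i != Ordinal k0) && (i != Ordinal k1)) c i *: x i.
  apply: eq_bigr => i; rewrite -!val_eqE /= /swap_coef => /andP[ik ik1].
  by rewrite simpleE (negPf ik) (negPf ik1) addr0.
rewrite /swap_coef simple_l simple_r !eqxx orbT.
move: (\sum_(i < K | _) _) (x k) (x k.+1) => T u v.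
rewrite !scalerDl !scaleNr !scale1r !scalerBr; ring.
Qed.

Lemma sum_scale_sub (A : comAlgType int) (I : Type) (r : seq I) (P : pred I)
    (a : I -> int) (s d : I -> A) (y : A) :
  \sum_(i <- r | P i) a i *: (s i - y * d i) =
  \sum_(i <- r | P i) a i *: s i - y * \sum_(i <- r | P i) a i *: d i.
Proof.
rewrite mulr_sumr -sumrB; apply: eq_bigr => i _.
by rewrite scalerBr -scalerAr.
Qed.

Lemma witt_swap_mul k (p q : Pol) :
  witt (p - (Xv k - Xv k.+1) * q) =
  witt p - ((Xv k * Xv k - Xv k.+1 * Xv k.+1) * q + (Xv k - Xv k.+1) * witt q).
Proof.
have wB u v : witt (u - v) = witt u - witt v.
  by rewrite addrC -scaleN1r lin_witt scaleN1r addrC.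
apply: (etrans (wB _ _)); apply: (congr1 (fun u => witt p - u)).
apply: (etrans (congr1 witt (mulrBl q (Xv k) (Xv k.+1)))).
apply: (etrans (wB _ _)).
apply: (etrans (congr1 (fun u => u - _) (wittX k q))).
apply: (etrans (congr1 (fun u => _ - u) (wittX k.+1 q))).
by move: (Xv k) (Xv k.+1) (witt q) => x y r; ring.
Qed.

(** Both sides change in the same way under each sigma_k, by the identity for
    w s_k, so their difference is invariant; it has no constant term. The
    difference of the statements for two sequences c is Monk's rule. *)
Theorem schubert_raising (w : sinf) M (c : nat -> int) :
    (forall i, (M <= i)%N -> w i = i) -> (forall i, (M <= i)%N -> c i = 0) ->
  lform M c * schubert w + witt (schubert w) =
  \sum_(ij : 'I_M.+1 * 'I_M.+1 | is_cover w ij.1 ij.2)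
     cover_coef M c w ij.1 ij.2 *: schubert (w * transp ij.1 ij.2)%g.
Proof.
have [n ln] := ubnP (len w); elim: n w c ln => [//|n IH] w c ln wM cM.
set R := \sum_(ij | _) _; set LS := lform M c * schubert w.
suff f0 : LS + witt (schubert w) - R = 0 by exact: subr0_eq f0.
apply: sigma_invariant_eq0 => [k|].
  have sE (p q r : Pol) : sigma k (p + q - r) = sigma k p + sigma k q - sigma k r.
    have Lf := lin_sigma k.
    have sN u : sigma k (- u) = - sigma k u by rewrite -scaleN1r (lin_scale _ _ Lf) scaleN1r.
    have sD u v : sigma k (u + v) = sigma k u + sigma k v.
      by rewrite -[u in LHS]scale1r Lf scale1r.
    by rewrite sD sN sD.
  apply: (etrans (sE _ _ _)).
  pose D : Pol := if descent w k then schubert (w * simple k)%g else 0.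
  pose E : Pol := if descent w k then
    \sum_(ij : 'I_M.+1 * 'I_M.+1 | is_cover (w * simple k)%g ij.1 ij.2)
       cover_coef M (swap_coef k c) (w * simple k)%g ij.1 ij.2 *:
       schubert (w * simple k * transp ij.1 ij.2)%g
    else 0.
  have sS : sigma k (schubert w) = schubert w - (Xv k - Xv k.+1) * D by exact: sigma_schubert.
  apply: (@divided_difference_step _ (Xv k) (Xv k.+1) _ _ D _ (witt D) _ E _ _ _ (c k - c k.+1)).
  - apply: (etrans (sigma_lform _ _ cM)); exact: congr1 sS.
  - apply: (etrans (sigma_witt _ _)); apply: (etrans (congr1 witt sS)).
    apply: (etrans (witt_swap_mul _ _ _)); exact: erefl.
  - have sub (ij : 'I_M.+1 * 'I_M.+1) := sigma_schubert k (w * transp ij.1 ij.2)%g.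
    apply: (etrans (lin_sum _ _ _ (lin_sigma k))).
    have cs := @cover_sum_swap _ schubert M w k c wM cM.
    apply: (etrans _ (congr1 (fun u => R - (Xv k - Xv k.+1) * u) cs)).
    apply: (etrans _ (sum_scale_sub _ _ _ _ _ _)).
    apply: eq_bigr => ij _; apply: (etrans (lin_scale _ _ (lin_sigma k))).
    exact: (congr1 (fun u : Pol => _ *: u) (sub ij)).
  - rewrite /D /E; case: (boolP (descent w k)) => wk; last first.
      apply: (etrans (eq_add (mulr0 _) (lin0 lin_witt))); exact: addr0.
    have kM := descent_lt wM wk.
    apply: (etrans (congr1 (fun u => u * _ + _) (esym (swap_coef_sum (fun i => Xv i) c kM)))).
    have lw := len_descent wk; apply: IH.
    + by rewrite -ltnS -lw.
    + by move=> i Mi; rewrite mulsE simpleE !gtn_eqF ?wM //; lia.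
    + by move=> i Mi; rewrite /swap_coef simpleE !gtn_eqF ?cM //; lia.
have mB (p q r : Pol) : (p + q - r)@_mone = p@_mone + q@_mone - r@_mone.
  by rewrite mcoeffB mcoeffD.
apply: (etrans (mB _ _ _)).
have R1 : R@_mone = 0.
  apply: (etrans (lin_sum _ _ _ (lin_mcoeff _))); apply: big1 => ij cv.
  apply: (etrans (mcoeffZ _ _ _)); apply: (etrans (congr1 (fun u => _ * u) (schubert_const _))).
    apply/eqP => w1; move: cv; rewrite /is_cover w1 len1; lia.
  exact: mulr0.
have z3 (x y z : int) : x = 0 -> y = 0 -> z = 0 -> x + y - z = 0.
  by move=> -> -> ->.
exact: z3 (mcoeff1_lform _ _ _) (mcoeff1_witt _) R1.
Qed.

End KeyIdentity.

(** * The operator Delta on padded polynomials *)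

Section Padding.
Local Open Scope ring_scope.
Implicit Types (lam : seq nat) (i j : nat).

Lemma mext_lin_comp (I : choiceType) (U W : lmodType int) (f : U -> W)
    (g : {cmonom I} -> U) p : linear f -> f (mext g p) = mext (fun m => f (g m)) p.
Proof.
move=> Lf; rewrite /mext (lin_sum _ _ _ Lf); apply: eq_bigr => m _.
by rewrite (lin_scale _ _ Lf).
Qed.

Lemma lin_mextE (I : choiceType) (U : lmodType int) (f : {malg int[{cmonom I}]} -> U) p :
  linear f -> f p = mext (fun m => f << m >>) p.
Proof.
move=> Lf; apply: (malg_lin_ext Lf); first exact: mext_is_linear.
by move=> m; rewrite mextU.
Qed.

Lemma scalez_nat (U : lmodType int) n (v : U) : n%:Z *: v = v *+ n.
Proof. by rewrite -natz scaler_nat. Qed.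

Lemma malgU_scale_mulrn (R : nzRingType) (K : monomType) (c : R) n (k : K) :
  << c *+ n *g k >> = c *: (<< k >> *+ n).
Proof. by rewrite malgUZ -scalerMnl scalerMnr. Qed.

Definition pderiv_monom v (m : {cmonom (nat + nat)%type}) : polyxy :=
  << divcm m (ucm v) >> *+ m v.

Lemma pderivE v p : pderiv v p = mext (pderiv_monom v) p.
Proof.
rewrite /pderiv /mext; apply: eq_bigr => m _; exact: malgU_scale_mulrn.
Qed.

Lemma lin_pderiv v : linear (pderiv v).
Proof.
move=> c p q; apply: (etrans (pderivE _ _)); apply: (etrans (mext_is_linear _ _ _ _)).
apply: esym; exact: (eq_add (congr1 (fun u => c *: u) (pderivE v p)) (pderivE v q)).
Qed.

Lemma malgU_exp (I : choiceType) (m : {cmonom I}) n :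
  exists2 m' : {cmonom I}, (<< m >> : {malg int[{cmonom I}]}) ^+ n = << m' >> &
    forall v, m' v = (n * m v)%N.
Proof.
elim: n => [|n [m' E mE]]; first by exists mone => // v; rewrite cm1.
exists (mmul m m') => [|v]; last by rewrite cmM mE mulSn.
apply: (etrans (exprS _ _)); apply: (etrans (congr1 (fun u => _ * u) E)).
exact: malgUM.
Qed.

Lemma malgU_prod (I : choiceType) (T : Type) (r : seq T) (F : T -> {malg int[{cmonom I}]})
    (e : T -> I -> nat) :
  (forall t, exists2 m : {cmonom I}, F t = << m >> & forall v, m v = e t v) ->
  exists2 m : {cmonom I}, \prod_(t <- r) F t = << m >> &
    forall v, m v = (\sum_(t <- r) e t v)%N.
Proof.
move=> H; elim: r => [|t r [m' E mE]].
  by exists mone => [|v]; rewrite big_nil ?cm1.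
have [m F_ mF] := H t; exists (mmul m m') => [|v]; last by rewrite cmM mE mF big_cons.
rewrite big_cons; apply: (etrans (congr1 (fun u => _ * u) E)).
by apply: (etrans (congr1 (fun u => u * _) F_)); exact: malgUM.
Qed.

Lemma padded_monomE lam (m : {cmonom nat}) : exists2 m' : {cmonom (nat + nat)%type},
  padded_monom lam m = << m' >> &
  (forall i, m' (inl i) = m i) /\ (forall i, m' (inr i) = (nth 0%N lam i - m i)%N).
Proof.
have [|mx Ex mxE] := @malgU_prod _ _ (finsupp m) (fun i => xvar i ^+ m i)
  (fun i v => (m i * ucm (inl i : nat + nat) v)%N).
  by move=> i; exact: malgU_exp.
have [|my Ey myE] := @malgU_prod _ _ (index_enum 'I_(size lam))
  (fun i : 'I_(size lam) => yvar i ^+ (nth 0%N lam i - m i)%N)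
  (fun (i : 'I_(size lam)) v => ((nth 0%N lam i - m i) * ucm (inr (i : nat) : nat + nat) v)%N).
  by move=> i; exact: malgU_exp.
exists (mmul mx my).
  apply: (etrans (congr1 (fun u => u * _) Ex)).
  by apply: (etrans (congr1 (fun u => _ * u) Ey)); exact: malgUM.
split=> i; rewrite cmM mxE myE.
  rewrite [X in (_ + X)%N]big1 ?addn0 => [|j _]; last by rewrite ucmE muln0.
  case: (boolP (i \in finsupp m)) => [im|nim].
    rewrite (big_fsetD1 i) //= ucmE eqxx muln1 big1_fset ?addn0 // => j.
    rewrite in_fsetD1 => /andP[ji _] _; rewrite ucmE.
    by case: eqP => [[E]|]; rewrite ?muln0 //; rewrite E eqxx in ji.
  rewrite big1_fset => [|j jm _]; first by move: nim; rewrite -cmE_eq0 => /eqP.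
  by rewrite ucmE; case: eqP => [[E]|]; rewrite ?muln0 //; rewrite -E jm in nim.
rewrite [X in (X + _)%N]big1 ?add0n => [|j _]; last by rewrite ucmE muln0.
case: (ltnP i (size lam)) => [il|li].
  rewrite (bigD1 (Ordinal il)) //= ucmE eqxx muln1 big1 ?addn0 // => j ji.
  rewrite ucmE; case: eqP => [[E]|]; rewrite ?muln0 //.
  by case/negP: ji; apply/eqP/val_inj.
rewrite nth_default // big1 // => j _; rewrite ucmE.
by case: eqP => [[E]|]; rewrite ?muln0 //; have := ltn_ord j; rewrite E ltnNge li.
Qed.

(** The factor y_i of the padded monomial has exponent lambda_i - m_i, which is
    the multiplicity produced by differentiation. *)
Lemma Delta_term lam (m : {cmonom nat}) i : xvar i * pderiv (inr i) (padded_monom lam m) =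
  padded_monom lam (mmul (ucm i) m) *+ (nth 0%N lam i - m i).
Proof.
have [P PE [Px Py]] := padded_monomE lam m.
have [Q QE [Qx Qy]] := padded_monomE lam (mmul (ucm i) m).
have D : pderiv (inr i) << P >> = pderiv_monom (inr i) P.
  exact: etrans (pderivE _ _) (mextU _ _).
apply: (etrans (congr1 (fun u => xvar i * u) (etrans (congr1 (pderiv (inr i)) PE) D))).
apply: (etrans (mulrnAr _ _ _)); rewrite Py.
apply: (congr1 (fun u => u *+ _)); apply: (etrans (malgUM _ _)); apply: esym.
apply: (etrans QE); apply: (congr1 (fun u : {cmonom (nat + nat)%type} => << u >>)).
apply: cmonomP => -[j|j]; rewrite cmM divcmE !ucmE ?Qx ?Qy ?Px ?Py cmM ucmE /=.
  by rewrite subn0.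
by rewrite add0n subnDA subnAC.
Qed.

(** The bound on the exponents turns the truncated difference lambda_i - m_i
    into a difference of integers, which splits into the multiplication by the
    linear form and the derivation. *)
Lemma Delta_padded lam M (p : Pol) : (size lam <= M)%N ->
    (forall m, m \in msupp p -> forall i, (m i <= nth 0%N lam i)%N) ->
  Delta (mext (padded_monom lam) p) =
  - mext (padded_monom lam) (lform M (fun i => - (nth 0%N lam i)%:Z) * p + witt p).
Proof.
move=> lM bound; set T := mext (padded_monom lam).
have LT : linear T by exact: mext_is_linear.
have TN q : T (- q) = - T q.
  apply: (etrans (congr1 T (esym (scaleN1r q)))).
  by apply: (etrans (lin_scale _ _ LT)); exact: scaleN1r.
have term i : xvar i * pderiv (inr i) (T p) =
    mext (fun m => padded_monom lam (mmul (ucm i) m) *+ (nth 0%N lam i - m i)) p.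
  have Lx : linear (fun q => xvar i * pderiv (inr i) q).
    exact: lin_comp (lin_mul _) (lin_pderiv _).
  apply: (etrans (mext_lin_comp _ _ Lx)); apply: eq_mext => m _; exact: Delta_term.
have -> : Delta (T p) = \sum_(i < M) xvar i * pderiv (inr (i : nat)) (T p).
  apply: (etrans _ (esym (fsbig_ord _ M (fun i => xvar i * pderiv (inr i) (T p))))).
  apply: esym; apply: fsbig_widen => [//|i [_ /= iM]]; apply: (etrans (term i)).
  have Li : nth 0%N lam i = 0%N.
    by apply: nth_default; apply: leq_trans lM _; rewrite leqNgt; apply/negP.
  by rewrite /mext big1 // => m _; rewrite Li sub0n mulr0n scaler0.
pose f q := - T (lform M (fun i => - (nth 0%N lam i)%:Z) * q + witt q).
have Lf : linear f.
  have LN (q : polyxy) : linear (fun u : polyxy => - u).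
    by move=> c u v; rewrite opprD scalerN.
  apply: (lin_comp (LN 0)); apply: (lin_comp LT); apply: lin_add (lin_mul _) lin_witt.
apply: (etrans _ (esym (lin_mextE p Lf))).
apply: (etrans (eq_bigr _ (fun (i : 'I_M) _ => term i))).
rewrite /mext exchange_big /=; apply: eq_big_seq => m mp.
apply: (etrans (esym (scaler_sumr _ _ _ _))); apply: (congr1 (fun u => _ *: u)).
have -> : \sum_(i < M) padded_monom lam (mmul (ucm (i : nat)) m) *+ (nth 0%N lam i - m i) =
   T (\sum_(i < M) << mmul (ucm (i : nat)) m >> *+ (nth 0%N lam i - m i)).
  apply: esym; apply: (etrans (lin_sum _ _ _ LT)); apply: eq_bigr => i _.
  by apply: (etrans (lin_muln _ _ LT)); apply: (congr1 (fun u => u *+ _)); exact: mextU.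
apply: (etrans _ (TN _)); apply: (congr1 T).
have fm : (finsupp m `<=` seq_fset tt (iota 0 M))%fset.
  apply/fsubsetP => i; rewrite -cmE_neq0 seq_fsetE mem_iota /= add0n => mi.
  rewrite ltnNge; apply: contra mi => Mi; rewrite -leqn0.
  by rewrite (leq_trans (bound m mp i)) // nth_default // (leq_trans lM).
have wE : witt << m >> = \sum_(i < M) << mmul (ucm (i : nat)) m >> *+ m i.
  apply: (etrans (wittU m)); apply: (etrans (witt_monomEw fm)).
  rewrite -(big_mkord xpredT (fun i => << mmul (ucm i) m >> *+ m i)) /index_iota subn0.
  apply: perm_big; rewrite -[X in perm_eq _ X]undup_id ?iota_uniq //.
  exact: seq_fset_perm.
have lE : lform M (fun i => - (nth 0%N lam i)%:Z) * << m >> =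
   \sum_(i < M) - (<< mmul (ucm (i : nat)) m >> *+ nth 0%N lam i).
  apply: (etrans (mulr_suml _ _ _ _)); apply: eq_bigr => i _.
  apply: (etrans (esym (scalerAl _ _ _))); apply: (etrans (scaleNr _ _)).
  apply: (congr1 -%R); apply: (etrans (scalez_nat _ _)).
  apply: (congr1 (fun u => u *+ _)); exact: malgUM.
apply: esym; apply: (etrans (congr1 -%R (eq_add lE wE))).
apply: (etrans (congr1 -%R (esym (big_split _ _ _ _ _)))).
rewrite -[LHS]sumrN; apply: eq_bigr => i _.
have := bound m mp i; move: (<< mmul _ _ >>) (m i) (nth _ _ _) => u a b ab.
by rewrite opprD opprK mulrnBr.
Qed.

End Padding.

(** * Permutations below a dominant one *)

Lemma ncard_count M (S : set nat) (P : pred nat) (v : sinf) :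
  (forall k, S k <-> (v k < M.+1)%N /\ P (v k)) ->
  ncard S = (\sum_(p < M.+1) P p)%N.
Proof.
move=> SP; pose s := [seq (v^-1)%g p | p <- iota 0 M.+1 & P p].
have SE : S = [set` s]%classic.
  apply/seteqP; split=> k.
    move=> /SP[vM Pv]; apply/mapP; exists (v k); last by rewrite sinfVK.
    by rewrite mem_filter mem_iota Pv.
  move=> /= /mapP[p]; rewrite mem_filter mem_iota => /andP[Pp pM] ->.
  by apply/SP; rewrite sinfKV.
have us : uniq s.
  by rewrite map_inj_uniq ?filter_uniq ?iota_uniq //; exact: sinf_injective.
rewrite /ncard SE; have -> : #|` fset_set [set` s]|%fset = size s.
  apply/perm_size/uniq_perm => // k.
  rewrite in_fset_set; last exact: finite_seq.
  by apply/idP/idP => [/set_mem|ks] //; exact/mem_set.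
rewrite size_map size_filter -sum1_count big_mkcond /=.
by rewrite -(big_mkord xpredT (fun p => P p : nat)) /index_iota subn0.
Qed.

(** Passing to the cover w t_ij creates the inversion (i, j); besides this it
    replaces an inversion (p, i) by (p, j), or (j, q) by (i, q), when the value at
    p or q lies between w i and w j. The new ones are inversions of v because
    v j < v i. *)
Lemma cover_inversions (w v : sinf) i j : is_cover w i j -> inversions_sub w v ->
  inversions_sub (w * transp i j)%g v <-> (v j < v i)%N.
Proof.
move=> cv wv; have [ij wij] := cover_lt cv; split=> [H|vji].
  by apply: H => //; rewrite !mulsE !transpE !eqxx gtn_eqF.
move=> p q pq; rewrite !mulsE !transpE.
have nocross r : (i < r < j)%N -> (w i < w r)%N -> (w r < w j)%N -> False.
  by move=> irj; have := cover_between cv irj; lia.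
have nij : (j == i) = false by lia.
have [pi|npi] := eqVneq p i; last have [pj|npj] := eqVneq p j.
- have nqi : (q == i) = false by lia.
  rewrite nqi pi; rewrite pi in pq; have [->//|nqj wqj] := eqVneq q j.
  case: (ltnP (w q) (w i)) => [/(wv _ _ pq)//|wiq].
  have {}wiq : (w i < w q)%N.
    by rewrite ltn_neqAle wiq andbT sinf_eq; lia.
  case: (ltngtP q j) => [qj|jq|]; last by lia.
    by case: (@nocross q); rewrite ?pq.
  exact: ltn_trans (wv _ _ jq wqj) vji.
- have nqi : (q == i) = false by lia.
  have nqj : (q == j) = false by lia.
  rewrite nqi nqj pj => wqi; rewrite pj in pq.
  exact: wv pq (ltn_trans wqi wij).
- have [qi|nqi] := eqVneq q i.
    by rewrite qi in pq * => wjp; exact: wv pq (ltn_trans wij wjp).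
  have [qj|nqj] := eqVneq q j; last exact: wv.
  rewrite qj in pq * => wip; case: (ltnP (w j) (w p)) => [/(wv _ _ pq)//|wpj].
  have {}wpj : (w p < w j)%N by rewrite ltn_neqAle wpj andbT sinf_eq.
  case: (ltngtP p i) => [lpi|ip|]; last by move/eqP: npi.
    exact: ltn_trans vji (wv _ _ lpi wip).
  by case: (@nocross p); rewrite ?ip.
Qed.

Section Dominant.
Variables (lam : seq nat) (pi : sinf).
Hypothesis lam_part : is_partition lam.
Hypothesis pi_dom : is_dominant lam pi.
Notation L i := (nth 0%N lam i).

(** The definition of dom(lambda), read in the column pi p. *)
Lemma dominant_lt i p : (pi p < L i)%N = (i < p)%N && (pi p < pi i)%N.
Proof. by rewrite -pi_dom /in_diagram sinfVK. Qed.

Lemma partition_anti i j : (i <= j)%N -> (L j <= L i)%N.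
Proof.
move=> ij; case: (ltnP j (size lam)) => jl; last by rewrite nth_default.
have il := leq_ltn_trans ij jl.
by apply: (sorted_leq_nth (leT := geq)) => //; [move=> x y z /= xy yz; exact: leq_trans yz xy | exact: leqnn].
Qed.

(** An inversion (p, q) of pi with i <= p satisfies
    pi q < lambda_p <= lambda_i. *)
Lemma dominant_row_bound (w : sinf) (m : {cmonom nat}) : inversions_sub w pi ->
  m \in msupp (schubert w) -> forall i, (m i <= L i)%N.
Proof.
move=> wpi mw i; apply: schubert_bound wpi _ mw => p q ip pq qp.
by apply: leq_trans (partition_anti ip); rewrite dominant_lt pq qp.
Qed.

Variables (w : sinf) (M : nat).
Hypothesis piM : forall i, (M <= i)%N -> pi i = i.
Hypothesis w_pi : inversions_sub w pi.

(** Here pi permutes the points up to M, among which lambda_i are smaller than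
    lambda_i. *)
Lemma dominant_part_sum i : (i <= M)%N -> L i = (\sum_(p < M.+1) (pi p < L i)%N)%N.
Proof.
move=> iM.
have LM : (L i <= M)%N.
  rewrite leqNgt; apply/negP => LM; have := dominant_lt i M; rewrite piM // LM => /esym/andP[lt1 lt2].
  by have := piM (ltnW lt2) => /sinf_injective E; rewrite E in lt2; lia.
have piB (p : 'I_M.+1) : (pi p < M.+1)%N.
  rewrite (@sinf_lt_fix pi M.+1) // => x Mx; apply: piM; exact: ltnW.
pose h (p : 'I_M.+1) : 'I_M.+1 := Ordinal (piB p).
have hI : injective h.
  by move=> p q /(congr1 val) /= /sinf_injective E; apply: val_inj.
have <- : (\sum_(v < M.+1) (v < L i)%N)%N = (\sum_(p < M.+1) (pi p < L i)%N)%N.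
  exact: (reindex_inj hI).
rewrite -(big_mkord xpredT (fun v => (v < L i)%N : nat)).
rewrite (@big_cat_nat _ _ _ (L i)) //=; last exact: leqW.
rewrite [X in (_ + X)%N]big_nat_cond [X in (_ + X)%N]big1 ?addn0; last first.
  by move=> v /andP[/andP[Lv _] _]; rewrite ltnNge Lv.
rewrite big_nat_cond (eq_bigr (fun=> 1%N)) -?big_nat_cond; last first.
  by move=> v /andP[/andP[_ ->]].
by rewrite sum_nat_const_nat subn0 muln1.
Qed.

Variables (i j : nat).
Hypothesis cv : is_cover w i j.
Hypothesis jM : (j <= M)%N.

Local Open Scope ring_scope.

(** By [dominant_part_sum] both sides are sums over p, which are compared term
    by term. The point p = j gives the summand 1 if pi j < pi i. A point p with
    i < p < j and w p < w i is counted by lambda_i, and its sign cancels it; one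
    with w j < w p gives an inversion (p, j) of pi, so pi j < lambda_p <= lambda_i
    and pi j < pi i; its sign accounts for A, and lambda_i counts it if and only
    if B does. A point p < i with w j < w p gives an inversion (p, i) of pi and is
    not counted by B. A point p > j contributes to lambda_i - lambda_j if and only if pi j < pi p < pi i, and then
    w j < w p because (j, p) is not an inversion of pi. *)
Lemma cover_coef_dominant :
  - cover_coef M (fun i => - (L i)%:Z) w i j =
  (if (pi j < pi i)%N then
    1 + ncard (cover_A w (w i) (w j)) + ncard (cover_B pi w (w i) (w j)) else 0)%N%:Z.
Proof.
have [ij wij] := cover_lt cv; have iM : (i <= M)%N := leq_trans (ltnW ij) jM.
pose A p := (w j < w p)%N && (i < p < j)%N.
pose B p := (w j < w p)%N && (pi j < pi p < pi i)%N.
have EA : ncard (cover_A w (w i) (w j)) = (\sum_(p < M.+1) A p)%N.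
  apply: (ncard_count (v := w^-1%g)) => k; rewrite /cover_A /= /A !sinfVK sinfKV.
  by split=> [[wk /andP[ik kj]]|[_ /andP[wk ikj]]]; rewrite ?wk ?ik ?kj; split=> //; lia.
have EB : ncard (cover_B pi w (w i) (w j)) = (\sum_(p < M.+1) B p)%N.
  apply: (ncard_count (v := w^-1%g)) => k; rewrite /cover_B /B /mkset !mulsE !sinfVK sinfKV.
  split=> [[wk /andP[pk ki]]|[_ /andP[wk ->]]] //; rewrite wk pk ki; split=> //.
  rewrite ltnNge; apply/negP => Mk; move: ki; rewrite piM; last exact: ltnW.
  move=> ki; have := piM (ltnW (ltn_trans Mk ki)) => /sinf_injective E.
  by rewrite E in ki; lia.
rewrite /cover_coef EA EB (dominant_part_sum iM) (dominant_part_sum jM).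
have -> : (if (pi j < pi i)%N then (1 + \sum_(p < M.+1) A p + \sum_(p < M.+1) B p)%N else 0%N)
  = (\sum_(p < M.+1) if (pi j < pi i)%N then ((p == j :> nat) + A p + B p)%N else 0%N)%N.
  case: ifP => _; last by rewrite big1.
  rewrite !big_split /=; congr (_ + _ + _)%N.
  rewrite (bigD1 (Ordinal (jM : j < M.+1)%N)) //= eqxx big1 // => p.
  by rewrite -val_eqE /= => /negPf ->.
rewrite -!natz !natr_sum -!sumrN -!big_split /= -sumrN; apply: eq_bigr => p _.
have btw := cover_between cv (p := p).
rewrite !dominant_lt /between_sign /A /B.
case: (ltngtP p i) => [pi_|ip|pE]; last first.
- by rewrite pE ltnn (ltn_eqF ij) !andbF /= (ltnNge j i) (ltnW ij) /=; case: ifP.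
- case: (ltngtP p j) => [pj|jp|pE]; last first.
  + by rewrite pE !ltnn /=; case: ifP.
  + rewrite andbF /=.
    have wjp : (w p < w j)%N || (w j < w p)%N.
      by rewrite -neq_ltn sinf_eq gtn_eqF.
    case: (ltngtP (pi p) (pi j)) => [pij|pji|/sinf_injective E]; last by rewrite E ltnn in jp.
      have pii : (pi p < pi i)%N.
        have : (pi p < L i)%N.
          by apply: leq_trans (partition_anti (ltnW ij)); rewrite dominant_lt jp.
        by rewrite dominant_lt => /andP[].
      by rewrite pii !andbF; case: ifP.
    have -> : (w j < w p)%N.
      by case/orP: wjp => // /(w_pi jp); rewrite ltnNge (ltnW pji).
    case: ifP => [_|/negbT]; first by case: (pi p < pi i)%N.
    rewrite -leqNgt => ji; have -> : (pi p < pi i)%N = false.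
      by apply/negbTE; rewrite -leqNgt (leq_trans ji) // ltnW.
    by [].
  + rewrite !ip !pj /= in btw *; case: (ltnP (w j) (w p)) btw => [wjp _|_ /=].
      have pjp := w_pi pj wjp.
      have -> : (pi j < pi i)%N.
        have : (pi j < L i)%N.
          by apply: leq_trans (partition_anti (ltnW ip)); rewrite dominant_lt pj.
        by rewrite dominant_lt => /andP[].
      have -> : (w p < w i)%N = false.
        by apply/negbTE; rewrite -leqNgt ltnW // (ltn_trans wij wjp).
      rewrite pjp /=.
      by case: (pi p < pi i)%N.
    rewrite orbF => /(_ isT) wpi; rewrite wpi (w_pi ip wpi) /=.
    by case: ifP.
- rewrite (ltn_trans pi_ ij) (ltn_eqF (ltn_trans pi_ ij)) !andbF /=.
  rewrite (ltnNge j) (ltnW (ltn_trans pi_ ij)) /=.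
  have -> : [&& (w j < w p), (pi j < pi p) & (pi p < pi i)]%N = false.
    apply/negP => /and3P[wjp _]; rewrite ltnNge.
    by rewrite (ltnW (w_pi pi_ (ltn_trans wij wjp))).
  by case: ifP.
Qed.

End Dominant.

Lemma pi_coverP (pi w : sinf) i j : inversions_sub w pi ->
  (w i < w j)%N /\ pi_cover pi w (w i) (w j) <-> is_cover w i j && (pi j < pi i)%N.
Proof.
move=> wpi; rewrite /pi_cover /bruhat_cover transp_mul; split.
  move=> [wij [lw le_pi]]; have ij : (i < j)%N.
    case: (ltngtP i j) => // [ji|E]; last by rewrite E ltnn in wij.
    by have := len_transp_lt ji wij; rewrite transpC lw ltnNge leqnSn.
  have cv : is_cover w i j by rewrite /is_cover ij lw eqxx.
  by rewrite cv; apply/(cover_inversions cv wpi); exact: left_weak_inversions.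
case/andP => cv pij; have [ij wij] := cover_lt cv; split=> //; split.
  by case/andP: cv => _ /eqP.
by apply: inversions_left_weak; apply/(cover_inversions cv wpi).
Qed.

Local Open Scope classical_set_scope.
Local Open Scope ring_scope.

Theorem theorem1p1 (lam : seq nat) (pi w : sinf) :
  is_partition lam ->
  is_dominant lam pi ->
  left_weak_le w pi ->
  Delta (padded_schubert lam w) =
  \sum_(ab \in [set ab : nat * nat | (ab.1 < ab.2)%N /\ pi_cover pi w ab.1 ab.2])
    (1 + ncard (cover_A w ab.1 ab.2) + ncard (cover_B pi w ab.1 ab.2))%N%:R *:
      padded_schubert lam (transp ab.1 ab.2 * w)%g.
Proof.
move=> lam_part pi_dom /left_weak_inversions wpi.
have [Mw wMw] := sinf_bound w; have [Mp piMp] := sinf_bound pi.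
pose M := (Mw + Mp + size lam)%N.
have wM i : (M <= i)%N -> w i = i by move=> Mi; apply: wMw; lia.
have piM i : (M <= i)%N -> pi i = i by move=> Mi; apply: piMp; lia.
have lM : (size lam <= M)%N by rewrite leq_addl.
pose c i : int := - (nth 0%N lam i)%:Z.
have cM i : (M <= i)%N -> c i = 0.
  by move=> Mi; rewrite /c nth_default ?oppr0 // (leq_trans lM).
have LT : linear (mext (padded_monom lam)) by exact: mext_is_linear.
(* The values a < b are replaced by their positions i, j in w, so that the pairs
   run over a finite type. *)
pose good (ij : 'I_M.+1 * 'I_M.+1) := is_cover w ij.1 ij.2 && (pi ij.2 < pi ij.1)%N.
pose value (ij : 'I_M.+1 * 'I_M.+1) := (w ij.1, w ij.2).
pose r := [seq value ij | ij <- [seq ij <- index_enum ('I_M.+1 * 'I_M.+1)%type | good ij]].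
have -> : [set ab : nat * nat | (ab.1 < ab.2)%N /\ pi_cover pi w ab.1 ab.2] = [set` r].
  apply/seteqP; split=> [[a b]|[a b]] /=.
    rewrite -{1 2}(sinfKV w a) -{1 2}(sinfKV w b).
    set i := (w^-1)%g a; set j := (w^-1)%g b => /(pi_coverP _ _ wpi) ijP.
    have /andP[cv pij] := ijP; have [ij wij] := cover_lt cv.
    have jM : (j < M.+1)%N.
      rewrite ltnS leqNgt; apply/negP => Mj; move: pij; rewrite piM; last exact: ltnW.
      move=> ji; have /sinf_injective E := piM (pi i) (ltnW (ltn_trans Mj ji)).
      by rewrite E in ji; lia.
    apply/mapP; exists (Ordinal (ltn_trans ij jM), Ordinal jM).
      by rewrite mem_filter /good /= ijP mem_index_enum.
    by congr pair; exact/esym/sinfKV.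
  move=> /mapP[[i j]]; rewrite mem_filter => /andP[/= ijP _] [-> ->].
  exact/pi_coverP.
rewrite -fsbig_seq; last first.
  rewrite map_inj_uniq ?filter_uniq ?index_enum_uniq // => -[i j] [i' j'] /= [].
  by move=> /sinf_injective/val_inj -> /sinf_injective/val_inj ->.
apply: (etrans (Delta_padded lM _)).
  by move=> m; exact: (dominant_row_bound lam_part pi_dom wpi).
apply: (etrans (congr1 (fun u => - mext (padded_monom lam) u) (schubert_raising wM cM))).
apply: (etrans (congr1 -%R (lin_sum _ _ _ LT))).
apply: (etrans (esym (sumrN _ _ _))).
rewrite [RHS]big_map [RHS]big_filter /good [RHS]big_mkcondr; apply: eq_bigr => -[i j] cv.
apply: (etrans (congr1 -%R (lin_scale _ _ LT))).
apply: (etrans (esym (scaleNr _ _))).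
have jM : (j <= M)%N by rewrite -ltnS.
have E := cover_coef_dominant lam_part pi_dom piM wpi cv jM.
apply: (etrans (congr1 (fun a => a *: _) E)); rewrite /value /=.
case: ifP => _; last exact: scale0r.
by rewrite -natz transp_mul.
Qed.
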